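(* For every fixed $\alpha > 0$, if the arc probability of the random digraph $\mathcal{D}(n,p)$ satisfies $\log n/\sqrt{n} \ll p = p(n) \leq 1$, then asymptotically almost surely $$(1/2 - \alpha)\, n p \;\leq\; r_{\ell}(\mathcal{D}(n,p), \mathcal{H}) \;\leq\; (1/2 + \alpha)\, n p .$$
   Context: $\mathcal{D}(n,p)$ is the random digraph on vertex set $[n]$ in which each ordered pair $(u,v)$, $u \neq v$, is an arc independently with probability $p$. $\mathcal{H}$ is the digraph property of containing a directed Hamilton cycle. For a digraph $D$ and a monotone increasing property $\mathcal{P}$, the local resilience $r_\ell(D,\mathcal{P})$ is the smallest non-negative integer $r$ such that there is a subdigraph $H \subseteq D$ with maximum out-degree $\Delta^+(H)\le r$ and maximum in-degree $\Delta^-(H) \le r$ such that $D \setminus H$ (delete the arcs of $H$) does not satisfy $\mathcal{P}$. ''Asymptotically almost surely'' (a.a.s.) means with probability tending to $1$ as $n \to \infty$; $f \ll g$ means $f/g \to 0$. Logarithms are natural. *)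

(* Defs.v *)
From HB Require Import structures.
From mathcomp Require Import all_boot all_order all_algebra all_fingroup.
From mathcomp Require Import all_classical all_reals all_analysis.
Set Implicit Arguments. Unset Strict Implicit. Unset Printing Implicit Defensive.
Import Order.TTheory GRing.Theory Num.Theory.
Local Open Scope ring_scope.

Definition digraph (n : nat) := {set 'I_n * 'I_n}.

Definition all_arcs (n : nat) : digraph n := [set uv | uv.1 != uv.2].

(* D(n,p): probability that the random digraph satisfies the boolean event E.
   Each arc of all_arcs n is present independently with probability p. *)
Definition Dnp_prob {R : realType} (n : nat) (p : R) (E : digraph n -> bool) : R :=
  \sum_(A : digraph n | A \subset all_arcs n)
     (p ^+ #|A| * (1 - p) ^+ (#|all_arcs n| - #|A|)%N) * (E A)%:R.

Definition outdeg n (H : digraph n) (v : 'I_n) : nat := #|[set w | (v, w) \in H]|.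
Definition indeg n (H : digraph n) (v : 'I_n) : nat := #|[set w | (w, v) \in H]|.

(* Directed Hamilton cycle: a cyclic ordering sigma 0, sigma 1, ..., sigma (n-1)
   of all vertices with every arc (sigma i, sigma (i+1 mod n)) present. *)
Definition perm_type (T : finType) := {perm T}.
Definition hamiltonian n (D : digraph n) : bool :=
  [exists s : perm_type 'I_n, [forall i : 'I_n, (s i, s (ordS i)) \in D]].

Definition destroyable n (D : digraph n) (r : nat) : bool :=
  [exists H : digraph n,
     [&& H \subset D,
         [forall v, (outdeg H v <= r)%N && (indeg H v <= r)%N]
       & ~~ hamiltonian (D :\: H)]].

(* Local resilience r_l(D, Hamiltonicity): the least r with destroyable D r.
   For n >= 1 such r exists and is <= n - 1 (take H = D), so the minimum over
   r in {0..n} is the true minimum; the default value n is never used then. *)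
Definition local_resilience_ham n (D : digraph n) : nat :=
  \big[minn/n]_(r < n.+1 | destroyable D r) r.

(* Main.v *)
Require Import Defs.
From HB Require Import structures.
From mathcomp Require Import all_boot all_order all_algebra all_fingroup.
From mathcomp Require Import zify ring lra.
Set Implicit Arguments.
Unset Strict Implicit.
Unset Printing Implicit Defensive.

(* Upper bound: delete all arcs inside a set X of floor(n/2)+1 vertices. No
   Hamilton cycle can avoid using an arc inside X, and a.a.s. all degrees inside X
   are at most (1/2+a)np.

   Lower bound: let D' be D minus the deleted arcs; its semidegrees are at least
   (1/2+3a/4)np. Put s = floor(sqrt n).
   - A random partition gives two disjoint s-sets A, B such that every vertex has
     more than (1/2+a/4)ps out- and in-neighbours in each of them.
   - Greedily build a small "ladder": s disjoint paths leading from A to B, with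
     s-1 switches. A switch consists of arcs u->y, u->z, x->y, x->z of D', so that
     its two tracks can be crossed; its existence is a pigeonhole statement because
     (np/2)^2 > n. The tracks are led into and out of the switches by paths of
     length four, which exist since second neighbourhoods in D' have more than n/2
     vertices. Consecutive switches share a track, so the switches connect
     everything.
   - Partition the remaining vertices randomly into s-sets V_1, ..., V_m, again with
     all degrees into each V_i above (1/2+a/4)ps. By Hall's theorem and the
     pseudorandomness of D there are perfect matchings
     B -> V_1 -> ... -> V_m -> A in D'. Together with the ladder they form a
     permutation whose arcs lie in D', each cycle of which runs through the ladder.
   - If the two tracks of a switch lie on different cycles, crossing them merges the
     two cycles. Treating all switches in turn leaves a single Hamilton cycle. *)

(** * Matchings and permutations *)

Definition out_nbrs (T : finType) (D : {set T * T}) (B S : {set T}) :=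
  [set w in B | [exists v in S, (v, w) \in D]].

Lemma out_nbrsU (T : finType) (D : {set T * T}) (B S1 S2 : {set T}) :
  out_nbrs D B (S1 :|: S2) = out_nbrs D B S1 :|: out_nbrs D B S2.
Proof.
apply/setP => w; rewrite !inE -andb_orr; congr (_ && _).
apply/existsP/orP => [[v /andP[]]|[]/existsP[v /andP[vS vw]]]; rewrite ?inE.
- by case/orP=> vS vw; [left|right]; apply/existsP; exists v; rewrite vS.
- by exists v; rewrite inE vS.
- by exists v; rewrite inE vS orbT.
Qed.

(** Induction on the size of [A]. A nonempty proper subset that is critical is matched into its own
    neighbourhood, and the rest of [A] keeps Hall's condition in what remains of [B]. If no subset
    is critical, any one arc may be used, as deleting its head costs each set at most one
    neighbour. *)
Lemma hall (T : finType) (D : {set T * T}) (A B : {set T}) :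
  (forall S : {set T}, S \subset A -> #|S| <= #|out_nbrs D B S|) ->
  exists2 f : T -> T, {in A &, injective f}
    & {in A, forall v, (f v \in B) && ((v, f v) \in D)}.
Proof.
have [k] := ubnP #|A|; elim: k A B => // k IH A B ltAk hA.
have [->|[a aA]] := set_0Vmem A; first by exists id => v; rewrite inE.
case: (boolP [exists S : {set T},
   [&& S \proper A, S != set0 & #|out_nbrs D B S| <= #|S|]]).
- case/existsP=> S /and3P[pSA S0 leS].
  have sSA := proper_sub pSA.
  have [f1 f1i f1P] : exists2 f : T -> T, {in S &, injective f}
    & {in S, forall v, (f v \in B) && ((v, f v) \in D)}.
    apply: IH => [|S' sS']; last exact/hA/(subset_trans sS').
    by apply: leq_trans (proper_card pSA) _; rewrite -ltnS.
  have [f2 f2i f2P] : exists2 f : T -> T, {in A :\: S &, injective f}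
    & {in A :\: S, forall v, (f v \in B :\: out_nbrs D B S) && ((v, f v) \in D)}.
    apply: IH => [|S' sS'].
      have := cardsID S A; rewrite (setIidPr sSA) => E.
      by move: S0; rewrite -card_gt0; lia.
    have [sS'A dS'] := subsetDP sS'.
    have -> : out_nbrs D (B :\: out_nbrs D B S) S' =
              out_nbrs D B (S :|: S') :\: out_nbrs D B S.
      rewrite out_nbrsU setDUl setDv set0U.
      by apply/setP => w; rewrite !inE andbA.
    have := hA (S :|: S'); rewrite subUset sSA sS'A => /(_ isT).
    rewrite cardsU (_ : S :&: S' = set0) ?cards0 ?subn0; last first.
      by apply/eqP; rewrite setI_eq0 disjoint_sym.
    rewrite cardsD (setIidPr _) ?out_nbrsU ?subsetUl // -out_nbrsU.
    lia.
  exists (fun v => if v \in S then f1 v else f2 v) => [v w vA wA|v vA].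
  + case: ifPn => vS; case: ifPn => wS; first exact: f1i.
    * move=> E; have /andP[] : (f2 w \in B :\: out_nbrs D B S) && ((w, f2 w) \in D).
        by apply: f2P; rewrite inE wS.
      rewrite !inE -E; have /andP[-> vD] := f1P _ vS.
      rewrite andbT => /negP[]; apply/existsP; exists v; exact/andP.
    * move=> E; have /andP[] : (f2 v \in B :\: out_nbrs D B S) && ((v, f2 v) \in D).
        by apply: f2P; rewrite inE vS.
      rewrite !inE E; have /andP[-> vD] := f1P _ wS.
      rewrite andbT => /negP[]; apply/existsP; exists w; exact/andP.
    * by apply: f2i; rewrite inE ?vS ?wS.
  + case: ifPn => vS; first exact: f1P.
    have /andP[] : (f2 v \in B :\: out_nbrs D B S) && ((v, f2 v) \in D).
      by apply: f2P; rewrite inE vS.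
    by rewrite inE => /andP[_ ->] ->.
- rewrite negb_exists => /forallP tight.
  have : 0 < #|out_nbrs D B [set a]|.
    by apply: leq_trans (hA [set a] _); rewrite ?cards1 ?sub1set.
  case/card_gt0P=> b; rewrite inE => /andP[bB /existsP[a' /andP[]]].
  rewrite inE => /eqP-> abD {a'}.
  have [f fi fP] : exists2 f : T -> T, {in A :\ a &, injective f}
    & {in A :\ a, forall v, (f v \in B :\ b) && ((v, f v) \in D)}.
    apply: IH => [|S sS].
      by have := cardsD1 a A; rewrite aA; lia.
    have [->|S0] := eqVneq S set0; first by rewrite cards0.
    have pS : S \proper A.
      apply/properP; split; first exact: subset_trans sS (subsetDl _ _).
      by exists a => //; apply/negP => /(subsetP sS); rewrite !inE eqxx.
    have := tight S; rewrite pS S0 /= -ltnNge => lt.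
    have -> : out_nbrs D (B :\ b) S = out_nbrs D B S :\ b.
      by apply/setP => w; rewrite !inE andbA.
    have := cardsD1 b (out_nbrs D B S); case: (_ \in _); lia.
  exists (fun v => if v == a then b else f v) => [v w vA wA|v vA].
  + case: eqVneq => [->|va]; case: eqVneq => [->|wa] //.
    * have /fP : w \in A :\ a by rewrite !inE wa.
      by rewrite !inE => /andP[/andP[/negP fwb _] _] E; case: fwb; rewrite E.
    * have /fP : v \in A :\ a by rewrite !inE va.
      by rewrite !inE => /andP[/andP[/negP fwb _] _] E; case: fwb; rewrite E.
    * by apply: fi; rewrite !inE ?va ?wa.
  + case: eqVneq => [->|va]; first by rewrite bB.
    have /fP : v \in A :\ a by rewrite !inE va.
    by rewrite !inE => /andP[/andP[_ ->] ->].
Qed.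

(** The identity for the number of cycles after multiplication by a transposition is applied to [s]
    and to [tperm a b * s]. If both had [a] and [b] on different cycles, each would have one cycle
    fewer than the other. *)
Lemma porbit_switch (T : finType) (s : {perm T}) (a b : T) :
  b \notin porbit s a -> b \in porbit (tperm a b * s)%g a.
Proof.
move=> ba; have ab : a != b by apply: contra ba => /eqP->; rewrite porbit_id.
have E1 := porbits_mul_tperm s a b; have E2 := porbits_mul_tperm (tperm a b * s)%g a b.
move: E1 E2; rewrite /= mulgA tperm2 mul1g ab porbit_sym ba /= (porbit_sym _ b a).
by case: (b \in porbit (tperm a b * s)%g a) => //=; lia.
Qed.

Lemma porbit_perm1 (T : finType) (s : {perm T}) v : porbit s (s v) = porbit s v.
Proof. by apply/eqP; rewrite eq_porbit_mem -{1}[s]expg1 mem_porbit. Qed.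

(** A switch is crossed only if its two ends lie on different cycles. Hence cycles only ever merge,
    and each cycle of the result is a union of cycles of [s0]; the second conclusion records
    this. *)
Lemma merge_cycles (T : finType) (D : {set T * T}) (s0 : {perm T})
    (ps : seq (T * T)) :
  (forall v, (v, s0 v) \in D) ->
  uniq (unzip1 ps ++ unzip2 ps) ->
  {in ps, forall ab, ((ab.1, s0 ab.2) \in D) && ((ab.2, s0 ab.1) \in D)} ->
  exists s : {perm T}, [/\ forall v, (v, s v) \in D,
    forall v, porbit s (s0 v) = porbit s v
    & {in ps, forall ab, porbit s ab.1 = porbit s ab.2}].
Proof.
move=> s0D ups psD.
(* The induction needs the last clause: off the pairs already treated the successors are still those
   of [s0]. Since all ends are distinct, the next switch finds its original successors in place. *)
have H (qs : seq (T * T)) : uniq (unzip1 qs ++ unzip2 qs) ->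
    {in qs, forall ab, ((ab.1, s0 ab.2) \in D) && ((ab.2, s0 ab.1) \in D)} ->
  exists s : {perm T}, [/\ forall v, (v, s v) \in D,
    forall v, porbit s (s0 v) = porbit s v,
    {in qs, forall ab, porbit s ab.1 = porbit s ab.2}
    & forall v, v \notin unzip1 qs ++ unzip2 qs -> s v = s0 v].
  elim: qs => [_ _|[a b] qs IH /=].
    by exists s0; split=> // v; rewrite porbit_perm1.
  rewrite mem_cat inE !negb_or -!andbA => /and4P[aq1 ab aq2].
  rewrite cat_uniq /= negb_or -!andbA => /and5P[u1 bq1 hq bq2 u2] qsD.
  have [|ab'|s [sD ss0 sq sE]] := IH.
  - by rewrite cat_uniq u1 hq.
  - by move=> abq; apply: qsD; rewrite inE abq orbT.
  have sa : s a = s0 a by apply: sE; rewrite mem_cat negb_or aq1.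
  have sb : s b = s0 b by apply: sE; rewrite mem_cat negb_or bq1.
  have [/andP[D1 D2]] : ((a, s0 b) \in D) && ((b, s0 a) \in D).
    by apply: (qsD (a, b)); rewrite inE eqxx.
  have [bs|bs] := boolP (b \in porbit s a).
    exists s; split=> // [[a' b']|v]; last first.
      by rewrite !inE !mem_cat !inE !negb_or => /and4P[_ v1 _ v2]; apply: sE; rewrite mem_cat negb_or v1.
    rewrite inE => /predU1P[[-> ->]|]; last exact: sq.
    by apply/eqP; rewrite eq_porbit_mem porbit_sym.
  set s' := (tperm a b * s)%g.
  have s'ab : porbit s' a = porbit s' b.
    by apply/eqP; rewrite eq_porbit_mem porbit_sym; apply: porbit_switch.
  have s'a : s' a = s b by rewrite permM tpermL.
  have s'b : s' b = s a by rewrite permM tpermR.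
  have s'E v : v != a -> v != b -> s' v = s v.
    by move=> va vb; rewrite permM tpermD // eq_sym.
  have s'1 v : porbit s' (s v) = porbit s' v.
    have [->|va] := eqVneq v a; first by rewrite -s'b porbit_perm1.
    have [->|vb] := eqVneq v b; first by rewrite -s'a porbit_perm1.
    by rewrite -s'E // porbit_perm1.
  have s's v w : porbit s v = porbit s w -> porbit s' v = porbit s' w.
    move/eqP; rewrite eq_porbit_mem => /porbitP[i ->].
    elim: i => [|i IHi]; first by rewrite expg0 perm1.
    by rewrite expgSr permM s'1.
  exists s'; split=> [v|v|[a' b']|v].
  - have [->|va] := eqVneq v a; first by rewrite s'a sb.
    have [->|vb] := eqVneq v b; first by rewrite s'b sa.
    by rewrite s'E.
  - exact/s's/ss0.
  - by rewrite inE => /predU1P[[-> ->] //|abq]; apply/s's/sq.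
  - rewrite !inE !mem_cat !inE !negb_or => /and4P[va v1 vb v2].
    by rewrite s'E // sE // mem_cat negb_or v1.
by have [s [? ? ? _]] := H _ ups psD; exists s.
Qed.

(** * Ladders *)

(* Tracks from I to O covering L: g maps each vertex of L off O to its successor.
   The pairs in ps are the switches, at which the successors may be exchanged. The
   last two fields say that any two vertices of K are linked through tracks and
   switches, tested on functions h that are constant along tracks and switches
   (later the cycle of a vertex). *)
Record ladder (T : finType) (D : {set T * T}) (L I O K : {set T}) (g : T -> T)
    (ps : seq (T * T)) : Prop := Ladder {
  ladder_inS : I \subset L;
  ladder_outS : O \subset L;
  ladder_inj : {in L :\: O &, injective g};
  ladder_in : {in L :\: O, forall v, g v \in L :\: I};
  ladder_arc : {in L :\: O, forall v, (v, g v) \in D};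
  ladder_uniq : uniq (unzip1 ps ++ unzip2 ps);
  ladder_pair : {in ps, forall ab, (ab.1 \in L :\: O) && (ab.2 \in L :\: O)};
  ladder_switch : {in ps, forall ab,
    ((ab.1, g ab.2) \in D) && ((ab.2, g ab.1) \in D)};
  ladder_out : forall h : T -> {set T},
    {in L :\: O, forall v, h (g v) = h v} ->
    {in ps, forall ab, h ab.1 = h ab.2} ->
    {in L, forall v, exists2 w, w \in O & h v = h w};
  ladder_linked : forall h : T -> {set T},
    {in L :\: O, forall v, h (g v) = h v} ->
    {in ps, forall ab, h ab.1 = h ab.2} -> {in K &, forall v w, h v = h w} }.

Lemma ladder_start (T : finType) (D : {set T * T}) (A : {set T}) (u : T) :
  ladder D A A A [set u] id [::].
Proof.
split=> //; try by [move=> v; rewrite setDv inE | move=> v w; rewrite setDv inE].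
- by move=> h _ _ v vA; exists v.
- by move=> h _ _ v w /set1P-> /set1P->.
Qed.

(** Lengthens the track ending in [u] by one arc. The new end has the same value of [h] as [u], so
    it may join [K] if [u] is there. *)
Lemma ladder_path_step (T : finType) (D : {set T * T}) (L I O K : {set T})
    (g : T -> T) (ps : seq (T * T)) (u z : T) :
  ladder D L I O K g ps -> u \in O -> z \notin L -> (u, z) \in D ->
  ladder D (z |: L) I (z |: O :\ u) (if u \in K then z |: K else K)
    (fun v => if v == u then z else g v) ps.
Proof.
move=> [IL OL gi gin gD ups pL psw tot con] uO zL uzD.
have uL := subsetP OL _ uO.
have zO : z \notin O by apply: contra zL; apply/subsetP.
have zI : z \notin I by apply: contra zL; apply/subsetP.
(* The only vertex that gains a successor is [u]. *)
have E v : (v \in (z |: L) :\: (z |: O :\ u)) = (v == u) || (v \in L :\: O).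
  rewrite !inE; have [->|vz] := eqVneq v z.
    by rewrite (negbTE zL) andbF orbF; case: eqVneq zL => // ->; rewrite uL.
  by have [->|] := eqVneq v u; rewrite ?uL ?uO.
have uD : u \notin L :\: O by rewrite inE uO.
have Du v : v \in L :\: O -> (v == u) = false.
  by move=> vL; apply: contraNF uD => /eqP <-.
have gz v : v \in L :\: O -> g v != z.
  by move/gin; apply: contraTneq => ->; rewrite inE (negbTE zL) andbF.
have psu ab : ab \in ps -> (ab.1 == u = false) * (ab.2 == u = false).
  by move/pL/andP => [/Du ? /Du ?].
have hE (h : T -> {set T}) :
    {in (z |: L) :\: (z |: O :\ u), forall v, h (if v == u then z else g v) = h v} ->
    h z = h u /\ {in L :\: O, forall v, h (g v) = h v}.
  move=> hg; split=> [|v vL]; first by rewrite -[RHS]hg ?E ?eqxx.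
  by rewrite -[RHS]hg ?E ?vL ?orbT // Du.
split=> //.
- exact: subset_trans IL (subsetUr _ _).
- by apply: setUS; apply: subset_trans (subsetDl _ _) OL.
- move=> v w; rewrite !E => /predU1P[->|vL] /predU1P[->|wL] //; rewrite ?eqxx ?Du // => H.
  + by have := gz _ wL; rewrite H eqxx.
  + by have := gz _ vL; rewrite H eqxx.
  + exact: gi.
- move=> v; rewrite E => /predU1P[->|vL]; rewrite ?eqxx ?Du // ?inE ?eqxx ?zI //.
  by have := gin _ vL; rewrite inE => /andP[-> ->]; rewrite orbT.
- by move=> v; rewrite E => /predU1P[->|vL]; rewrite ?eqxx ?Du // gD.
- by move=> ab /pL /andP[a b]; rewrite !E a b !orbT.
- by move=> ab abp; rewrite !psu //; apply: psw.
- move=> h /hE[hz hg] hp v /setU1P[->|vL]; first by exists z; rewrite ?setU11.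
  have [w wO ->] := tot h hg hp _ vL.
  have [->|wu] := eqVneq w u; first by exists z; rewrite ?setU11.
  by exists w; rewrite // !inE wu wO orbT.
- move=> h /hE[hz hg] hp; have hK := con h hg hp.
  case: ifP => // uK.
  have H v : v \in z |: K -> h v = h u by case/setU1P=> [->|vL] //; apply: hK.
  by move=> v w vL wL; rewrite !H.
Qed.

(** The tracks ending in [u] and [x] continue to [z] and [y]; the other two arcs allow the exchange.
    The new pair forces [h x = h u], so a single end [u] in [K] brings both new ends into [K]. *)
Lemma ladder_switch_step (T : finType) (D : {set T * T}) (L I O K : {set T})
    (g : T -> T) (ps : seq (T * T)) (u x y z : T) :
  ladder D L I O K g ps -> u \in O -> x \in O -> u \in K -> u != x ->
  y \notin L -> z \notin L -> y != z ->
  (u, y) \in D -> (u, z) \in D -> (x, y) \in D -> (x, z) \in D ->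
  ladder D (y |: (z |: L)) I (y |: (z |: O :\ u :\ x)) (y |: (z |: K))
    (fun v => if v == x then y else if v == u then z else g v) ((u, x) :: ps).
Proof.
move=> [IL OL gi gin gD ups pL psw tot con] uO xO uK ux yL zL yz uyD uzD xyD xzD.
have uL := subsetP OL _ uO; have xL := subsetP OL _ xO.
have nL w : w \notin L -> (w \in O = false) * (w \in I = false).
  by move=> wL; split; apply: contraNF wL; apply/subsetP.
have nu w v : w \notin L -> v \in L -> (w == v) = false.
  by move=> wL vL; apply: contraNF wL => /eqP->.
have E v : (v \in (y |: (z |: L)) :\: (y |: (z |: O :\ u :\ x))) =
    [|| v == x, v == u | v \in L :\: O].
  rewrite !inE; have [->|vy] /= := eqVneq v y; first by rewrite (negbTE yL) !nu ?andbF.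
  have [->|vz] /= := eqVneq v z; first by rewrite (negbTE zL) !nu ?andbF.
  have [->|vx] /= := eqVneq v x; first by rewrite xL.
  by have [->|] := eqVneq v u; rewrite ?uL ?uO.
have uD : u \notin L :\: O by rewrite inE uO.
have xD : x \notin L :\: O by rewrite inE xO.
have Du v : v \in L :\: O -> (v == u) = false.
  by move=> vL; apply: contraNF uD => /eqP <-.
have Dx v : v \in L :\: O -> (v == x) = false.
  by move=> vL; apply: contraNF xD => /eqP <-.
have gn w v : w \notin L -> v \in L :\: O -> g v != w.
  by move=> wL /gin; apply: contraTneq => ->; rewrite inE (negbTE wL) andbF.
have psu ab : ab \in ps -> (ab.1 == u = false) * (ab.2 == u = false)
    * ((ab.1 == x = false) * (ab.2 == x = false)).
  by move/pL/andP => [A B]; rewrite !Du // !Dx.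
have hE (h : T -> {set T}) :
    {in (y |: (z |: L)) :\: (y |: (z |: O :\ u :\ x)),
       forall v, h (if v == x then y else if v == u then z else g v) = h v} ->
    [/\ h y = h x, h z = h u & {in L :\: O, forall v, h (g v) = h v}].
  move=> hg; split=> [||v vL]; first by rewrite -[RHS]hg ?E ?eqxx.
    by rewrite -[RHS]hg ?E ?eqxx ?orbT // (negbTE ux).
  by rewrite -[RHS]hg ?E ?vL ?orbT // Dx // Du.
split=> //.
- by rewrite setUA; apply: subset_trans IL (subsetUr _ _).
- by do 2 apply: setUS; do 2 apply: (subset_trans (subsetDl _ _)).
- move=> v w; rewrite !E => /or3P[/eqP->|/eqP->|vL] /or3P[/eqP->|/eqP->|wL] //;
    rewrite ?eqxx ?(negbTE ux) ?Du ?Dx // => H; try by move: yz; rewrite H eqxx.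
  + by have := gn _ _ yL wL; rewrite H eqxx.
  + by have := gn _ _ zL wL; rewrite H eqxx.
  + by have := gn _ _ yL vL; rewrite H eqxx.
  + by have := gn _ _ zL vL; rewrite H eqxx.
  + exact: gi.
- move=> v; rewrite E => /or3P[/eqP->|/eqP->|vL].
  + by rewrite eqxx !inE eqxx nL.
  + by rewrite (negbTE ux) eqxx !inE eqxx !orbT nL.
  + rewrite Dx // Du //; have := gin _ vL; rewrite !inE => /andP[-> ->].
    by rewrite !orbT.
- move=> v; rewrite E => /or3P[/eqP->|/eqP->|vL].
  + by rewrite eqxx.
  + by rewrite (negbTE ux) eqxx.
  + by rewrite Dx // Du // gD.
- have nps w : w \notin L :\: O -> w \notin unzip1 ps ++ unzip2 ps.
    move=> wL; rewrite mem_cat negb_or.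
    by apply/andP; split; apply/mapP => -[ab /pL /andP[A B] wE]; move: wL; rewrite wE ?A ?B.
  have := nps _ uD; have := nps _ xD.
  rewrite !mem_cat !negb_or => /andP[x1 x2] /andP[u1 u2].
  rewrite /= -[x :: _]cat1s uniq_catCA /= !mem_cat !inE !negb_or.
  by rewrite x1 x2 u1 u2 ux ups.
- move=> ab; rewrite inE => /predU1P[->|/pL /andP[a b]]; rewrite !E.
    by rewrite !eqxx orbT.
  by rewrite a b !orbT.
- move=> ab; rewrite inE => /predU1P[->|abp] /=.
    by rewrite !eqxx (negbTE ux) uyD xzD.
  by rewrite !psu //; apply: psw.
- move=> h /hE[hy hz hg] hp v.
  have hp' : {in ps, forall ab, h ab.1 = h ab.2}.
    by move=> ab abp; apply: hp; rewrite inE abp orbT.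
  case/setU1P=> [->|/setU1P[->|vL]].
  + by exists y; rewrite ?setU11.
  + by exists z; rewrite // !inE eqxx orbT.
  have [w wO ->] := tot h hg hp' _ vL.
  have [->|wx] := eqVneq w x; first by exists y; rewrite ?setU11.
  have [->|wu] := eqVneq w u; first by exists z; rewrite // !inE eqxx orbT.
  by exists w; rewrite // !inE wu wx wO !orbT.
- move=> h /hE[hy hz hg] hp.
  have hx : h x = h u by rewrite (hp (u, x)) ?inE ?eqxx.
  have hK : {in K &, forall v w, h v = h w}.
    by apply: con => // ab abp; apply: hp; rewrite inE abp orbT.
  have H v : v \in y |: (z |: K) -> h v = h u.
    by case/setU1P=> [->|/setU1P[->|vL]]; rewrite ?hy //; apply: hK.
  by move=> v w vL wL; rewrite !H.
Qed.

Lemma ladder_path (T : finType) (D : {set T * T}) (L I O K : {set T})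
    (g : T -> T) (ps : seq (T * T)) (u : T) (q : seq T) :
  ladder D L I O K g ps -> u \in O -> path (fun v w => (v, w) \in D) u q ->
  uniq q -> {in q, forall v, v \notin L} ->
  exists K' g', [/\ ladder D ([set v in q] :|: L) I (last u q |: O :\ u) K' g' ps,
    K \subset K' & u \in K -> last u q \in K'].
Proof.
elim: q u L O K g => [|z q IH] u L O K g lad uO /=.
  move=> _ _ _; exists K, g; split=> //.
  by rewrite setD1K // (_ : [set v in [::]] = set0) ?set0U //; apply/setP => v; rewrite !inE.
move=> /andP[uz zq] /andP[znq uq] qL.
have zL : z \notin L by apply: qL; rewrite inE eqxx.
have zO : z \notin O by apply: contra zL; apply/subsetP/(ladder_outS lad).
have := ladder_path_step lad uO zL uz.
set K1 := if _ then _ else _; set g1 := fun v => _ => lad1.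
have [|//|//|v vq|K' [g' [lad' KK' uK']]] := IH z _ _ _ _ lad1; rewrite ?setU11 //.
  rewrite !inE negb_or qL ?inE ?vq ?orbT // andbT.
  by apply: contraNneq znq => <-.
have KK1 : K \subset K1 by rewrite /K1; case: ifP => // _; apply: subsetUr.
exists K', g'; split; last 1 first.
- by move=> uK; apply: uK'; rewrite /K1 uK setU11.
- move: lad'; rewrite setU1K; last by rewrite !inE (negbTE zO) andbF.
  by congr (ladder D _ _ _ _ _ _); apply/setP => v; rewrite !inE orbCA orbA.
- exact: subset_trans KK1 KK'.
Qed.

Definition no_loop (T : finType) (D : {set T * T}) := forall v, (v, v) \notin D.

(** Double counting of the walks from [u] forward to [y] and backward to [x], both outside [U]:
    there are at least [d * d] of them, more than there are vertices, so some [x] is reached through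
    two different [y]. As [u] is in [U], this [x] is not [u]. *)
Lemma rung_exists (T : finType) (D : {set T * T}) (U : {set T}) (u : T) (d : nat) :
  no_loop D -> u \in U -> #|T| < d * d ->
  (forall v, d + #|U| <= #|[set w | (v, w) \in D]|) ->
  (forall v, d + #|U| <= #|[set w | (w, v) \in D]|) ->
  exists x y z, [/\ x \notin U, y \notin U, z \notin U, uniq [:: x; y; z]
    & [&& (u, y) \in D, (u, z) \in D, (x, y) \in D & (x, z) \in D]].
Proof.
move=> nl uU Td dout din.
have degD (S : {set T}) : d + #|U| <= #|S| -> d <= #|S :\: U|.
  by have := cardsID U S; have := subset_leq_card (subsetIr S U); lia.
set Y := [set w | (u, w) \in D] :\: U.
have dY : d <= #|Y| by apply: degD.
pose m := \sum_(y in Y) #|[set x | (x, y) \in D] :\: U|.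
have m1 : d * d <= m.
  apply: (@leq_trans (\sum_(y in Y) d)); first by rewrite sum_nat_const leq_mul2r dY orbT.
  by apply: leq_sum => y _; apply: degD.
have mE : m = \sum_(x in ~: U) #|[set y in Y | (x, y) \in D]|.
  under [RHS]eq_bigr do rewrite -sum1_card.
  rewrite /m; under eq_bigr do rewrite -sum1_card.
  rewrite (exchange_big_dep (mem (~: U))) /=; last first.
    by move=> y x _; rewrite !inE => /andP[].
  apply: eq_bigr => x; rewrite inE => xU; apply: eq_bigl => y.
  by rewrite !inE xU.
have [x xU] : exists2 x, x \in ~: U & 1 < #|[set y in Y | (x, y) \in D]|.
  apply/exists_inP; apply: contraLR m1 => /exists_inPn H.
  rewrite -ltnNge mE; apply: leq_ltn_trans Td.
  apply: (@leq_trans (\sum_(x in ~: U) 1)); last by rewrite sum1_card max_card.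
  by apply: leq_sum => x /H; rewrite -leqNgt.
case/card_gt1P=> y [z [+ + yz]]; rewrite !inE in xU *.
move=> /andP[/andP[yU uy] xy] /andP[/andP[zU uz] xz].
exists x, y, z; split=> //; last by rewrite uy uz xy xz.
rewrite /= !inE yz negb_or !andbT; apply/andP; split.
  by apply: contraTneq xy => ->; apply: nl.
by apply: contraTneq xz => ->; apply: nl.
Qed.


Definition rungs (T : finType) (D : {set T * T}) (M : nat) :=
  forall (U : {set T}) u, (#|U| <= M)%N -> u \in U ->
  exists x y z, [/\ x \notin U, y \notin U, z \notin U, uniq [:: x; y; z]
    & [&& (u, y) \in D, (u, z) \in D, (x, y) \in D & (x, z) \in D]].

(** [U] holds the vertices in use or reserved, the two ends among them. With three inner vertices,
    the second neighbourhoods of the two ends can meet in the middle. *)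
Definition links (T : finType) (D : {set T * T}) (M : nat) :=
  forall (U : {set T}) v w, (#|U| <= M)%N -> v \in U -> w \in U ->
  exists q, [/\ size q = 3, uniq q, {in q, forall x, x \notin U}
    & path (fun x y => (x, y) \in D) v (rcons q w)].

(** [F] is a reserve of vertices that later steps still need; the link takes only its target [w]
    from it. The 4 counts three inner vertices and [w]. *)
Lemma ladder_link (T : finType) (D : {set T * T}) (M : nat) (L I O K F : {set T})
    (g : T -> T) (ps : seq (T * T)) (u w : T) :
  links D M -> ladder D L I O K g ps -> u \in O -> w \notin L -> w \in F ->
  #|L| + #|F| <= M ->
  exists L' K' g', [/\ ladder D L' I (w |: O :\ u) K' g' ps,
     [/\ #|L'| = #|L| + 4, L \subset L' & L' :&: F = w |: (L :&: F)],
     K \subset K' & u \in K -> w \in K'].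
Proof.
move=> lk lad uO wL wF cM.
have uL := subsetP (ladder_outS lad) _ uO.
have {}cM : #|L :|: F| <= M by apply: leq_trans (leq_card_setU _ _) cM.
have [||q [sq uq qU pq]] := lk _ u w cM; rewrite ?inE ?uL ?wF ?orbT //.
have wq : w \notin q by apply/negP => /qU; rewrite inE wF orbT.
have [||K' [g' [lad' KK' uK']]] := ladder_path lad uO pq.
- by rewrite rcons_uniq wq.
- move=> v; rewrite mem_rcons inE => /predU1P[-> //|/qU].
  by rewrite inE negb_or => /andP[].
rewrite last_rcons in lad' uK'.
exists ([set v in rcons q w] :|: L), K', g'; split=> //; split.
- rewrite cardsU disjoint_setI0 ?cards0 ?subn0; last first.
    rewrite disjoint_subset; apply/subsetP => v; rewrite !inE mem_rcons inE.
    by case/predU1P=> [-> //|/qU]; rewrite inE negb_or => /andP[].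
  rewrite cardsE (card_uniqP _) ?rcons_uniq ?wq // size_rcons sq.
  by rewrite addnC.
- exact: subsetUr.
- apply/setP => v; rewrite !inE mem_rcons inE.
  have [->|vw] /= := eqVneq v w; first by rewrite wF.
  have [/qU|//] := boolP (v \in q); rewrite inE negb_or => /andP[/negbTE-> /negbTE->].
  by rewrite andbF.
Qed.

(** One running track, with current end [u], meets the tracks starting in [ar] one after another. In
    each round a rung [x], [y], [z] is found at [u], the track of [a] is led to [x], crosses the
    switch to [y] and is led to its target [b], while the running track goes on to [z]. A round
    costs 4 + 2 + 4 = 10 vertices. [Q] collects the targets already reached, all of them linked to
    the running track. *)
Lemma ladder_rungs (T : finType) (D : {set T * T}) (M : nat) (F I : {set T})
    (ar br : seq T) (L O K Q : {set T}) (g : T -> T) (ps : seq (T * T)) (u : T) :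
  rungs D M -> links D M ->
  ladder D L I O K g ps -> u \in O -> u \in K ->
  size br = size ar -> uniq ar -> uniq br ->
  {in ar, forall a, [/\ a \in O, a != u & a \notin Q]} ->
  {in br, forall b, b \notin L} -> {subset br <= F} ->
  Q \subset O -> Q \subset K -> u \notin Q ->
  #|L| + #|F| + 10 * size ar <= M ->
  exists L' O' K' g' ps' u', [/\ ladder D L' I O' K' g' ps',
    [/\ u' \in O', u' \in K' & u' \notin Q :|: [set b in br]],
    [/\ #|L'| = #|L| + 10 * size ar, #|O'| = #|O| &
        L' :&: F = [set b in br] :|: (L :&: F)] &
    Q :|: [set b in br] \subset O' /\ Q :|: [set b in br] \subset K'].
Proof.
move=> rg lk; elim: ar br L O K Q g ps u => [|a ar IH] [|b br] //= L O K Q g ps u lad uO uK.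
  move=> _ _ _ _ _ _ QO QK uQ _; exists L, O, K, g, ps, u.
  have -> : [set b in [::]] = set0 :> {set T} by apply/setP => v; rewrite !inE.
  by rewrite setU0 set0U muln0 addn0; split.
move=> [sz] /andP[aar uar] /andP[bbr ubr] arP brP brF QO QK uQ cM.
have [aO au aQ] : [/\ a \in O, a != u & a \notin Q] by apply: arP; rewrite inE eqxx.
have bF : b \in F by apply: brF; rewrite inE eqxx.
have bL : b \notin L by apply: brP; rewrite inE eqxx.
have OL := ladder_outS lad.
have uL := subsetP OL _ uO.
have cU : #|L :|: F| <= M.
  by apply: leq_trans (leq_card_setU _ _) (leq_trans (leq_addr _ _) cM).
have [|x [y [z [xU yU zU]]]] := rg _ u cU; first by rewrite inE uL.
rewrite /= !inE negb_or andbT => /andP[/andP[xy xz] yz] /and4P[uy uz xyD xzD].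
move: xU yU zU; rewrite !inE !negb_or => /andP[xL xF] /andP[yL yF] /andP[zL zF].
(* The rung joins the reserve for the moment, so that the link from [a] to [x] avoids [y] and
   [z]. *)
pose F1 := [set x; y; z] :|: F.
have cF1 : #|F1| <= #|F| + 3.
  apply: leq_trans (leq_card_setU _ _) _; rewrite addnC leq_add2l.
  by rewrite -setUA !cardsU1 cards1; do 2 case: (_ \notin _).
have [||L1 [K1 [g1 [lad1 [cL1 LL1 L1F] KK1 _]]]] := ladder_link lk lad aO xL (F := F1).
- by rewrite /F1 !inE eqxx.
- by clear -cF1 cM; lia.
have inL1 v : v \in F1 -> (v \in L1) = (v == x) || (v \in L).
  by move=> vF; have /setP/(_ v) := L1F; rewrite in_setU1 !in_setI vF !andbT.
have xO : x \notin O by apply: contra xL; apply/subsetP.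
have ux : u != x by apply: contraNneq xL => <-.
have yL1 : y \notin L1 by rewrite inL1 ?inE ?eqxx ?orbT // negb_or eq_sym xy.
have zL1 : z \notin L1 by rewrite inL1 ?inE ?eqxx ?orbT // negb_or eq_sym xz.
have bL1 : b \notin L1.
  by rewrite inL1 ?inE ?bF ?orbT // negb_or bL andbT; apply: contraTneq bF => ->.
set O1 := x |: O :\ a in lad1.
have uO1 : u \in O1 by rewrite in_setU1 in_setD1 uO (eq_sym u a) au orbT.
have xO1 : x \in O1 by rewrite setU11.
have uK1 : u \in K1 by apply: (subsetP KK1).
have := ladder_switch_step lad1 uO1 xO1 uK1 ux yL1 zL1 yz uy uz xyD xzD.
set g2 := fun v => _; set O2 := y |: (z |: O1 :\ u :\ x); set L2 := y |: (z |: L1) => lad2.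
have cO1 : #|O1| = #|O|.
  by rewrite cardsU1 !inE (negbTE xO) andbF (cardsD1 a O) aO.
have cO2 : #|O2| = #|O1|.
  have yO1 : y \notin O1 by apply: contra yL1; apply/subsetP/(ladder_outS lad1).
  have zO1 : z \notin O1 by apply: contra zL1; apply/subsetP/(ladder_outS lad1).
  have zP : z \notin O1 :\ u :\ x by rewrite !in_setD1 (negbTE zO1) !andbF.
  have yP : y \notin z |: O1 :\ u :\ x.
    by rewrite in_setU1 !in_setD1 (negbTE yO1) (negbTE yz) !andbF.
  rewrite /O2 (cardsU1 y) (cardsU1 z) zP yP (cardsD1 u O1) uO1 (cardsD1 x (O1 :\ u)).
  by rewrite in_setD1 xO1 eq_sym ux.
have yO2 : y \in O2 by rewrite setU11.
have bL2 : b \notin L2.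
  rewrite !inE !negb_or bL1 andbT; apply/andP; split.
    by apply: contraTneq bF => ->.
  by apply: contraTneq bF => ->.
have cL2 : #|L2| = #|L| + 6.
  by rewrite /L2 !cardsU1 !inE (negbTE yz) (negbTE yL1) zL1 cL1 /=; clear; lia.
have [|L3 [K3 [g3 [lad3 [cL3 LL3 L3F] KK3 yK3]]]] := ladder_link lk lad2 yO2 bL2 bF.
  by rewrite cL2; clear -cM; lia.
have L3E v : v \in F -> (v \in L3) = (v == b) || (v \in L).
  move=> vF; have /setP/(_ v) := L3F; rewrite !inE vF !andbT => ->.
  have nF w : w \notin F -> (v == w) = false by move=> wF; apply: contraNF wF => /eqP <-.
  by rewrite (nF y yF) (nF z zF) inL1 ?(nF x xF) // /F1 !inE vF orbT.
have nL v w : w \notin L -> v \in L -> (v == w) = false.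
  by move=> wL vL; apply: contraNF wL => /eqP <-.
set O3 := b |: O2 :\ y in lad3.
have O3P v : v \in O -> v != a -> v != u -> v \in O3.
  move=> vO va vu; have vL := subsetP OL _ vO.
  by rewrite !inE va vu vO !nL // ?orbT.
have bO2 : b \notin O2 by apply: contra bL2; apply/subsetP/(ladder_outS lad2).
have cO3 : #|O3| = #|O2|.
  by rewrite cardsU1 in_setD1 (negbTE bO2) andbF [RHS](cardsD1 y O2) yO2.
have zb : z != b by apply: contraNneq zF => ->.
(* The running track now ends in [z], and [b] is finished. *)
have := IH br L3 O3 K3 (b |: Q) g3 ((u, x) :: ps) z lad3.
case=> //.
- by rewrite in_setU1 in_setD1 (eq_sym z y) yz /O2 in_setU1 setU11 !orbT.
- by apply: (subsetP KK3); rewrite !inE eqxx orbT.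
- move=> a' a'r; have [a'O a'u a'Q] : [/\ a' \in O, a' != u & a' \notin Q].
    by apply: arP; rewrite inE a'r orbT.
  have a'L := subsetP OL _ a'O.
  split; first by apply: O3P => //; apply: contraNneq aar => <-.
    by rewrite nL.
  by rewrite !inE nL // (negbTE a'Q).
- move=> b' b'r; rewrite L3E; last by apply: brF; rewrite inE b'r orbT.
  rewrite negb_or brP ?inE ?b'r ?orbT // andbT.
  by apply: contraNneq bbr => <-.
- by move=> b' b'r; apply: brF; rewrite inE b'r orbT.
- apply/subsetP => v /setU1P[->|vQ]; first by rewrite setU11.
  apply: O3P; first exact: (subsetP QO).
    by apply: contraNneq aQ => <-.
  by apply: contraNneq uQ => <-.
- apply/subsetP => v /setU1P[->|vQ]; first by apply: yK3; rewrite setU11.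
  by apply/(subsetP KK3)/setU1r/setU1r/(subsetP KK1)/(subsetP QK).
- rewrite !inE negb_or zb /=; apply: contra zL => zQ.
  exact/(subsetP OL)/(subsetP QO).
- by rewrite cL3 cL2; clear -cM; lia.
move=> L' [O' [K' [g' [ps' [u' [lad' [u'O u'K u'Q] [cL' cO' L'F] [QO' QK']]]]]]].
have Qb : b |: Q :|: [set b in br] = Q :|: [set b0 in b :: br].
  by apply/setP => v; rewrite !inE; case: (v == b); case: (v \in Q); case: (v \in br).
rewrite Qb in u'Q QO' QK'.
exists L', O', K', g', ps', u'; split=> //; split.
- by rewrite cL' cL3 cL2; clear; lia.
- by rewrite cO' cO3 cO2.
- rewrite L'F; apply/setP => v; rewrite !inE.
  have [vF|vF] := boolP (v \in F); last first.
    by rewrite !andbF !orbF (_ : v == b = false) //; apply: contraNF vF => /eqP->.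
  by rewrite !andbT L3E //; case: (v == b); case: (v \in br); case: (v \in L).
Qed.

(** Padding: the running track is prolonged by [r] vertices, which later makes the number of
    vertices outside the ladder divisible by [s]. A rung serves here merely to supply one arc from
    [u] to a fresh vertex. *)
Lemma ladder_plain_steps (T : finType) (D : {set T * T}) (M r : nat)
    (L I O K F Q : {set T}) (g : T -> T) (ps : seq (T * T)) (u : T) :
  rungs D M -> ladder D L I O K g ps -> u \in O -> u \in K ->
  Q \subset O -> Q \subset K -> u \notin Q -> #|L| + #|F| + r <= M ->
  exists L' O' K' g' u', [/\ ladder D L' I O' K' g' ps,
    [/\ u' \in O', u' \in K' & u' \notin Q],
    [/\ #|L'| = #|L| + r, #|O'| = #|O| & L' :&: F = L :&: F] &
    Q \subset O' /\ Q \subset K'].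
Proof.
move=> rg; elim: r L O K g u => [|r IH] L O K g u lad uO uK QO QK uQ cM.
  by exists L, O, K, g, u; rewrite addn0; split.
have OL := ladder_outS lad.
have cU : #|L :|: F| <= M.
  by apply: leq_trans (leq_card_setU _ _) (leq_trans (leq_addr _ _) cM).
have [|_ [_ [z [_ _ + _ /and4P[_ uz _ _]]]]] := rg _ u cU.
  by rewrite inE (subsetP OL).
rewrite inE negb_or => /andP[zL zF].
have zO : z \notin O by apply: contra zL; apply/subsetP.
have := ladder_path_step lad uO zL uz; rewrite uK => lad1.
have cO1 : #|z |: O :\ u| = #|O|.
  by rewrite cardsU1 in_setD1 (negbTE zO) andbF [RHS](cardsD1 u O) uO.
have [||||||L' [O' [K' [g' [u' [lad' ? [cL' cO' L'F] ?]]]]]] := IH _ _ _ _ z lad1.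
- by rewrite setU11.
- by rewrite setU11.
- apply/subsetP => v vQ; rewrite !inE (subsetP QO) // andbT.
  by apply/orP; right; apply: contraNneq uQ => <-.
- exact: subset_trans QK (subsetUr _ _).
- by apply: contra zO; apply/subsetP.
- by rewrite cardsU1 zL; clear -cM; lia.
exists L', O', K', g', u'; split=> //; split.
- by rewrite cL' cardsU1 zL; clear; lia.
- by rewrite cO'.
- rewrite L'F; apply/setP => v; rewrite !inE.
  by have [->|] := eqVneq v z; rewrite ?(negbTE zF) ?andbF.
Qed.

(** The track of [a0] is the running one and ends in [b0]; the other [s - 1] tracks meet it in one
    round each. The size is [s] for [A], [10 * (s - 1)] for the rounds, [r] for the padding and 4
    for the last link. *)
Lemma ladder_between (T : finType) (D : {set T * T}) (M s r : nat) (A B : {set T}) :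
  rungs D M -> links D M -> [disjoint A & B] -> 0 < s -> #|A| = s -> #|B| = s ->
  12 * s + r <= M ->
  exists L K g ps, [/\ ladder D L A B K g ps, B \subset K
    & #|L| = 11 * s - 6 + r].
Proof.
move=> rg lk dAB s0 cA cB cM.
have [a0 [ar eA]] : exists a0 ar, enum A = a0 :: ar.
  by case E: (enum A) => [|a0 ar]; [move: s0; rewrite -cA cardE E | exists a0, ar].
have [b0 [br eB]] : exists b0 br, enum B = b0 :: br.
  by case E: (enum B) => [|b0 br]; [move: s0; rewrite -cB cardE E | exists b0, br].
have szA : s = (size ar).+1 by rewrite -cA cardE eA.
have szB : s = (size br).+1 by rewrite -cB cardE eB.
have [a0r uar] : a0 \notin ar /\ uniq ar.
  by apply/andP; have := enum_uniq A; rewrite eA.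
have [b0r ubr] : b0 \notin br /\ uniq br.
  by apply/andP; have := enum_uniq B; rewrite eB.
have mA v : v \in A = (v \in a0 :: ar) by rewrite -eA mem_enum.
have mB v : v \in B = (v \in b0 :: br) by rewrite -eB mem_enum.
have BA v : v \in B -> v \notin A.
  by move=> vB; apply/negP => vA; move: dAB; rewrite disjoint_subset => /subsetP/(_ _ vA)/negP.
have a0A : a0 \in A by rewrite mA inE eqxx.
have sz : size br = size ar by apply/eqP; rewrite -eqSS -szA -szB.
have arP : {in ar, forall a, [/\ a \in A, a != a0 & a \notin set0]}.
  move=> a ar_a; rewrite mA inE ar_a orbT inE; split=> //.
  by apply: contraNneq a0r => <-.
have brP : {in br, forall b, b \notin A}.
  by move=> b br_b; apply: BA; rewrite mB inE br_b orbT.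
have brB : {subset br <= B} by move=> b br_b; rewrite mB inE br_b orbT.
have [|L1 [O1 [K1 [g1 [ps [u1 [lad1 [u1O u1K u1Q] [cL1 cO1 L1F] [Q1O Q1K]]]]]]]] :=
  ladder_rungs rg lk (ladder_start D A a0) a0A (set11 a0) sz uar ubr arP brP brB
    (sub0set _) (sub0set _) (negbT (in_set0 a0)).
  by rewrite cA cB; clear -cM szA; lia.
rewrite set0U in u1Q Q1O Q1K.
have [|L2 [O2 [K2 [g2 [u2 [lad2 [u2O u2K u2Q] [cL2 cO2 L2F] [Q2O Q2K]]]]]]] :=
  ladder_plain_steps (r := r) (F := B) rg lad1 u1O u1K Q1O Q1K u1Q.
  by rewrite cL1 cA cB; clear -cM szA; lia.
have b0B : b0 \in B by rewrite mB inE eqxx.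
have b0L : b0 \notin L2.
  have /setP/(_ b0) := L2F; rewrite L1F !inE b0B !andbT => ->.
  by rewrite negb_or b0r BA.
have [|L3 [K3 [g3 [lad3 [cL3 _ _] KK3 uK3]]]] := ladder_link lk lad2 u2O b0L b0B.
  by rewrite cL2 cL1 cA cB; clear -cM szA; lia.
have BE : [set b in br] :|: [set b0] = B.
  by apply/setP => v; rewrite mB !inE orbC.
have b0O : b0 \notin O2 by apply: contra b0L; apply/subsetP/(ladder_outS lad2).
(* All targets are among the ends, and there are as many ends as targets. *)
have OB : B = b0 |: O2 :\ u2.
  apply/eqP; rewrite eqEcard; apply/andP; split.
    apply/subsetP => v; rewrite -BE => /setUP[vb|/set1P->]; last by rewrite setU11.
    rewrite in_setU1 in_setD1 (subsetP Q2O) // andbT; apply/orP; right.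
    by apply: contraNneq u2Q => <-.
  by rewrite cardsU1 in_setD1 (negbTE b0O) andbF cB -cA -cO1 -cO2 [X in _ <= X](cardsD1 u2) u2O.
exists L3, K3, g3, ps; split; first by rewrite OB.
  apply/subsetP => v; rewrite -BE => /setUP[vb|/set1P->]; last exact: uK3.
  exact/(subsetP KK3)/(subsetP Q2K).
by rewrite cL3 cL2 cL1 cA; clear -szA; lia.
Qed.

(** * From a ladder and matchings to a Hamilton cycle *)

(** Matchings run from each layer to the next: tracks end in layer 0 and start in layer [m.+1], so
    the ladder closes the circuit. The shift makes colour [k] layer [k.+1]. *)
Definition layer (T : finType) (L I O : {set T}) (ch : T -> nat) (m k : nat) :=
  if k == 0 then O else if k == m.+1 then I else [set v in ~: L | ch v == k.-1].

(** Track successors inside the ladder and matchings elsewhere form a permutation. After merging,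
    the whole ladder lies on one cycle, because its vertices are tied to ends in [O] and [O] is
    linked; every outside vertex runs into the ladder. *)
Lemma layers_one_cycle (T : finType) (D : {set T * T}) (L I O K : {set T})
    (g : T -> T) (ps : seq (T * T)) (ch : T -> nat) (m : nat) (u0 : T) :
  ladder D L I O K g ps -> O \subset K -> u0 \in L ->
  (forall v, v \notin L -> ch v < m) ->
  (forall k, k <= m -> exists2 f : T -> T,
     {in layer L I O ch m k &, injective f} &
     {in layer L I O ch m k, forall v,
        (f v \in layer L I O ch m k.+1) && ((v, f v) \in D)}) ->
  exists s : {perm T}, (forall v, (v, s v) \in D) /\ forall v w, porbit s v = porbit s w.
Proof.
move=> lad OK u0L chm HF; set A := layer L I O ch m in HF.
have OL := subsetP (ladder_outS lad); have IL := subsetP (ladder_inS lad).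
have {HF}/fin_all_exists2[F Fi FA] : forall k : 'I_m.+1, exists2 f : T -> T,
  {in A k &, injective f} & {in A k, forall v, (f v \in A k.+1) && ((v, f v) \in D)}.
  by move=> k; apply: HF; rewrite -ltnS.
pose lev v := if v \in O then 0 else (ch v).+1.
have lev_m v : v \notin L :\: O -> lev v < m.+1.
  by rewrite /lev inE negb_and negbK; case: (v \in O) => //= /chm.
have lev_A v : v \notin L :\: O -> v \in A (lev v).
  rewrite /lev inE negb_and negbK /A /layer; case: (boolP (v \in O)) => //= vO /[dup] vL /chm lt.
  by rewrite eqSS (ltn_eqF lt) !inE eqxx andbT.
(* [b w] is the layer whose matching reaches [w]. Equal images thus come from the same layer, where
   the matching is injective. *)
pose b w := if w \in I then m else ch w.
have bA k w : k <= m -> w \in A k.+1 -> b w = k /\ w \notin L :\: I.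
  rewrite /A /layer /= eqSS /b => km; case: eqVneq => [-> wI|_].
    by rewrite wI inE wI.
  rewrite !inE => /andP[wL /eqP]; rewrite (negbTE wL) andbF.
  by case: ifP => // /IL; rewrite (negbTE wL).
pose s0 v := if v \in L :\: O then g v else F (inord (lev v)) v.
have s0F v : v \notin L :\: O ->
    (s0 v \in A (lev v).+1) && ((v, s0 v) \in D).
  move=> vL; rewrite /s0 (negbTE vL).
  by have := FA (inord (lev v)) v; rewrite inordK ?lev_m // => /(_ (lev_A _ vL)).
have s0i : injective s0.
  move=> v w; have [vL|vL] := boolP (v \in L :\: O); have [wL|wL] := boolP (w \in L :\: O).
  - by rewrite /s0 vL wL => E; exact: (ladder_inj lad vL wL E).
  - have /andP[/bA] := s0F _ wL; rewrite -ltnS lev_m // => /(_ isT)[_ + _] E.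
    by rewrite -E /s0 vL (ladder_in lad).
  - have /andP[/bA] := s0F _ vL; rewrite -ltnS lev_m // => /(_ isT)[_ + _] E.
    by rewrite E /s0 wL (ladder_in lad).
  - move=> E; have /andP[/(bA _ _ (lev_m _ vL))[lv _] _] := s0F _ vL.
    have /andP[/(bA _ _ (lev_m _ wL))[lw _] _] := s0F _ wL.
    have lE : lev w = lev v by rewrite -lv -lw E.
    move: E; rewrite /s0 (negbTE vL) (negbTE wL) lE.
    by apply: Fi; rewrite inordK ?lev_m ?lev_A // -lE lev_A.
have s0D v : (v, s0 v) \in D.
  have [vL|vL] := boolP (v \in L :\: O); last by have /andP[] := s0F _ vL.
  by rewrite /s0 vL (ladder_arc lad).
have sw : {in ps, forall ab,
    ((ab.1, perm s0i ab.2) \in D) && ((ab.2, perm s0i ab.1) \in D)}.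
  move=> ab abp; rewrite !permE /s0.
  by have /andP[-> ->] := ladder_pair lad abp; apply: ladder_switch lad _ abp.
have pD v : (v, perm s0i v) \in D by rewrite permE.
have [s [sD ss0 sps]] := merge_cycles pD (ladder_uniq lad) sw.
exists s; split=> //.
have hL : {in L &, forall v w, porbit s v = porbit s w}.
  have hg : {in L :\: O, forall v, porbit s (g v) = porbit s v}.
    by move=> v vL; rewrite -[RHS]ss0 permE /s0 vL.
  move=> v w vL wL; have [v' v'O ->] := ladder_out lad hg sps vL.
  have [w' w'O ->] := ladder_out lad hg sps wL.
  by apply: (ladder_linked lad hg sps); apply: (subsetP OK).
suff H v : porbit s v = porbit s u0 by move=> v w; rewrite !H.
have [vL|] := boolP (v \in L); first exact: hL.
(* The successor of an outside vertex either has the next colour or lies in [I], so following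
   successors must reach the ladder. *)
have [j] := ubnP (m - ch v); elim: j v => // j IH v ltj vL.
rewrite -[LHS]ss0 permE.
have vLO : v \notin L :\: O by rewrite inE (negbTE vL) andbF.
have vO : v \notin O by apply: contra vL; apply: OL.
have /andP[+ _] := s0F _ vLO; rewrite /lev (negbTE vO) /A /layer /= eqSS.
have := chm _ vL; case: eqVneq => [_ _ /IL sL|_ lt]; first exact: hL.
by rewrite !inE => /andP[sL /eqP chE]; apply: IH => //; rewrite chE; lia.
Qed.

Lemma one_cycle_hamiltonian n (D : digraph n) (s : {perm 'I_n}) :
  (forall v, (v, s v) \in D) -> (forall v w, porbit s v = porbit s w) ->
  hamiltonian D.
Proof.
move=> sD one; case: n D s sD one => [|n] D s sD one.
  (* For [n = 0] there is no vertex to start from, but the condition on arcs is vacuous. *)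
  apply/existsP; exists (1%g : {perm 'I_0}).
  by apply/forallP => -[j j0]; have := j0; rewrite ltn0.
have oT (v : 'I_n.+1) : porbit s v = [set: 'I_n.+1].
  by apply/setP => w; rewrite inE -eq_porbit_mem (one w v) eqxx.
have cT : #|porbit s ord0| = n.+1 by rewrite oT cardsT card_ord.
pose f (i : 'I_n.+1) := iter i s ord0.
have fi : injective f.
  move=> i j E; have := uniq_traject_porbit s ord0; rewrite cT => U.
  apply/val_inj/eqP; rewrite -(nth_uniq ord0 _ _ U) ?size_traject; [|exact: ltn_ord|exact: ltn_ord].
  by rewrite (nth_traject _ (ltn_ord i)) (nth_traject _ (ltn_ord j)); apply/eqP.
apply/existsP; exists (perm fi : perm_type _).
apply/forallP => i; rewrite !permE.
suff -> : f (ordS i) = s (f i) by apply: sD.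
rewrite /f /= -iterS; have [lt|] := ltnP i.+1 n.+1; first by rewrite modn_small.
rewrite ltnS => ge; have iE : i = n :> nat by apply/eqP; rewrite eqn_leq ge -ltnS ltn_ord.
by rewrite iE modnn; have := iter_porbit s ord0; rewrite cT => ->.
Qed.

(** The positions of [X] along a Hamilton cycle and their cyclic shift would be disjoint sets of
    equal size, together exceeding [n]. *)
Lemma not_hamiltonian_independent n (D : digraph n) (X : {set 'I_n}) :
  n < 2 * #|X| -> {in X &, forall v w, (v, w) \notin D} -> ~~ hamiltonian D.
Proof.
move=> nX ind; apply/negP => /existsP[s /forallP sD].
pose Y := [set i | s i \in X].
have cY : #|Y| = #|X|.
  have -> : X = [set s i | i in Y].
    apply/setP => v; apply/idP/imsetP => [vX|[i]]; last by rewrite inE => ? ->.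
    by exists (s^-1 v)%g; rewrite ?inE permKV.
  by rewrite card_imset //; exact: perm_inj.
have dY : [disjoint Y & [set ordS i | i in Y]].
  rewrite -setI_eq0; apply/eqP/setP => j; rewrite !inE; apply/negP => /andP[jX /imsetP[i]].
  by rewrite inE => iX jE; have := ind _ _ iX jX; rewrite jE sD.
have := cardsU Y [set ordS i | i in Y].
rewrite (disjoint_setI0 dY) cards0 subn0 card_imset; last exact: ordS_inj.
have := subset_leq_card (subsetT (Y :|: [set ordS i | i in Y])).
rewrite cardsT card_ord cY => le E; move: le; rewrite E; lia.
Qed.

(** * Balanced partitions *)

Import Order.TTheory GRing.Theory Num.Theory.
Local Open Scope ring_scope.

(** * Arc counts and matchings between pseudorandom pairs *)

Lemma card_arcs_out (T : finType) (D : {set T * T}) (S U : {set T}) :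
  #|D :&: setX S U| = (\sum_(v in S) #|[set w in U | (v, w) \in D]|)%N.
Proof.
under eq_bigr do rewrite -sum1_card.
rewrite (pair_big_dep _ _ (fun _ _ => 1%N)) /= -sum1_card.
by apply: eq_bigl => -[v w]; rewrite !inE /= andbC andbA.
Qed.

Lemma card_arcs_in (T : finType) (D : {set T * T}) (S U : {set T}) :
  #|D :&: setX S U| = (\sum_(w in U) #|[set v in S | (v, w) \in D]|)%N.
Proof.
rewrite card_arcs_out; under eq_bigr do rewrite -sum1_card.
under [RHS]eq_bigr do rewrite -sum1_card.
rewrite (exchange_big_dep (mem U)) /=; last by move=> v w _; rewrite inE => /andP[].
by apply: eq_bigr => w wU; apply: eq_bigl => v; rewrite !inE wU.
Qed.

(** A set [S] violating Hall's condition sends all its arcs into the smaller set [N]. If [N] has at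
    most [s / 2] vertices, the pair [S], [N] carries too many arcs; otherwise the complements, with
    the two sides exchanged, do. *)
Lemma pseudorandom_matching (R : realFieldType) (T : finType)
    (D D0 : {set T * T}) (A B : {set T}) (s : nat) (p b c : R) :
  D \subset D0 -> #|A| = s -> #|B| = s -> 0 < p -> 0 <= c -> 2 * c < b ->
  (forall v, v \in A -> (1 / 2 + b) * (p * s%:R) <= #|[set w in B | (v, w) \in D]|%:R) ->
  (forall w, w \in B -> (1 / 2 + b) * (p * s%:R) <= #|[set v in A | (v, w) \in D]|%:R) ->
  (forall S U : {set T}, (#|S| <= s)%N -> (#|U| <= s)%N ->
    #|D0 :&: setX S U|%:R <= p * #|S|%:R * #|U|%:R + c * (p * s%:R) * (#|S| + #|U|)%:R) ->
  exists2 f : T -> T, {in A &, injective f}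
    & {in A, forall v, (f v \in B) && ((v, f v) \in D)}.
Proof.
move=> DD0 cA cB p0 c0 cb dA dB psr; apply: hall => S SA.
rewrite leqNgt; apply/negP => lt; set N := out_nbrs D B S in lt.
have NB : N \subset B by apply/subsetP => w; rewrite inE => /andP[].
have cS : (#|S| <= s)%N by rewrite -cA subset_leq_card.
have cN : (#|N| <= s)%N by rewrite -cB subset_leq_card.
have s0 : (0 < s)%N by apply: leq_trans cS; apply: leq_ltn_trans lt.
have q0 : 0 < p * s%:R by rewrite mulr_gt0 // ltr0n.
(* With [m] the larger and [k] the smaller side, dividing by [m p s] leaves [1/2 + b <= 1/2 + 2 c],
   against [2 * c < b]. *)
have key (m k e : nat) : (k <= m)%N -> (2 * k <= s)%N -> (0 < m)%N ->
    m%:R * ((1 / 2 + b) * (p * s%:R)) <= e%:R ->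
    e%:R <= p * m%:R * k%:R + c * (p * s%:R) * (m + k)%:R -> False.
  move=> km ks m0 h1 h2.
  have m0' : 0 < m%:R :> R by rewrite ltr0n.
  have km' : k%:R <= m%:R :> R by rewrite ler_nat.
  have ks' : 2 * k%:R <= s%:R :> R by rewrite -natrM ler_nat.
  have : p * m%:R * k%:R <= p * m%:R * (s%:R / 2).
    by rewrite ler_pM2l ?mulr_gt0 //; lra.
  have : c * (p * s%:R) * (m + k)%:R <= c * (p * s%:R) * (2 * m%:R).
    apply: ler_wpM2l; first by rewrite mulr_ge0 // ltW.
    by rewrite natrD; lra.
  have : 0 < (b - 2 * c) * (m%:R * (p * s%:R)) by apply: mulr_gt0; [rewrite subr_gt0 | exact: mulr_gt0].
  lra.
have sumge (X : {set T}) (F : T -> nat) (x : R) : (forall v, v \in X -> x <= (F v)%:R) ->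
    #|X|%:R * x <= (\sum_(v in X) F v)%:R.
  move=> H; rewrite natr_sum -sum1_card natr_sum mulr_suml.
  by apply: ler_sum => v vX; rewrite mul1r H.
have [sm|lg] := leqP (2 * #|N|) s.
  apply: (key #|S| #|N| #|D0 :&: setX S N|) => //.
  - exact: ltnW.
  - exact: leq_ltn_trans lt.
  - apply: (@le_trans _ _ #|D :&: setX S N|%:R); last first.
      by rewrite ler_nat subset_leq_card // setSI.
    rewrite card_arcs_out; apply: sumge => v vS.
    apply: le_trans (dA _ (subsetP SA _ vS)) _; rewrite ler_nat subset_leq_card //.
    apply/subsetP => w; rewrite !inE => /andP[-> vw]; rewrite vw andbT.
    by apply/existsP; exists v; rewrite vS.
  - exact: psr.
(* No vertex of [B'] has an in-neighbour in [S], so all its in-neighbours in [A] lie in [A']. *)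
pose A' := A :\: S; pose B' := B :\: N.
have cA' : #|A'| = (s - #|S|)%N by rewrite cardsD (setIidPr SA) cA.
have cB' : #|B'| = (s - #|N|)%N by rewrite cardsD (setIidPr NB) cB.
apply: (key #|B'| #|A'| #|D0 :&: setX A' B'|); rewrite ?cA' ?cB' //;
  try by clear -lt lg cS cN; lia.
- apply: (@le_trans _ _ #|D :&: setX A' B'|%:R); last first.
    by rewrite ler_nat subset_leq_card // setSI.
  rewrite card_arcs_in -cB'; apply: sumge => w; rewrite inE => /andP[wN wB].
  apply: le_trans (dB _ wB) _; rewrite ler_nat subset_leq_card //.
  apply/subsetP => v; rewrite !inE => /andP[-> vw]; rewrite vw !andbT.
  by apply: contra wN => vS; rewrite inE wB; apply/existsP; exists v; rewrite vS.
- have := psr A' B'; rewrite cA' cB' => /(_ (leq_subr _ _) (leq_subr _ _)) H.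
  by rewrite (mulrAC p) [(s - #|N| + _)%N]addnC.
Qed.

(** * Random equipartitions *)

Lemma subset_of_size (T : finType) (W : {set T}) k : (k <= #|W|)%N ->
  exists2 S : {set T}, S \subset W & #|S| = k.
Proof.
move=> kW; exists [set x in take k (enum W)].
  by apply/subsetP => x; rewrite inE => /mem_take; rewrite mem_enum.
rewrite cardsE (card_uniqP _) ?take_uniq ?enum_uniq //.
by rewrite size_takel // -cardE.
Qed.

Lemma equipartition (T : finType) (W : {set T}) (m s : nat) : #|W| = (m * s)%N ->
  exists ch : T -> nat, {in W, forall v, (ch v < m)%N} /\
    forall k, (k < m)%N -> #|[set v in W | ch v == k]| = s.
Proof.
elim: m W => [|m IH] W cW.
  by exists (fun=> 0%N); split=> // v; move/eqP: cW; rewrite cards_eq0 => /eqP->; rewrite inE.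
have [|S SW cS] := @subset_of_size _ W s; first by rewrite cW leq_pmull.
have [|ch [chm chs]] := IH (W :\: S).
  by rewrite cardsD (setIidPr SW) cW cS; lia.
exists (fun v => if v \in S then m else ch v); split.
  by move=> v vW; case: ifPn => // vS; rewrite ltnW // ltnS chm // inE vS.
move=> k; rewrite ltnS leq_eqVlt => /predU1P[->|km].
  rewrite -[RHS]cS; apply: eq_card => v; rewrite !inE.
  case: ifPn => [vS|vS]; first by rewrite eqxx (subsetP SW).
  by apply/negP => /andP[vW /eqP E]; have := chm v; rewrite inE vS vW E ltnn => /(_ isT).
rewrite -[RHS](chs _ km); apply: eq_card => v; rewrite !inE.
by case: ifP => //= _; rewrite gtn_eqF // andbF.
Qed.

Definition hits (T : finType) (Z B : {set T}) (pi : perm_type T) :=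
  #|[set v in B | pi v \in Z]|.

Lemma hitsU1 (T : finType) (Z B : {set T}) (pi : perm_type T) b : b \notin B ->
  hits Z (b |: B) pi = (hits Z B pi + (pi b \in Z))%N.
Proof.
move=> bB; rewrite /hits (cardsD1 b) !inE eqxx /= addnC; congr (_ + _)%N.
apply: eq_card => v; rewrite !inE; case: eqVneq => //= ->.
by rewrite (negbTE bB).
Qed.

(* Exposing the images of B one at a time, each new one hits Z with conditional
   probability at least z0 / #|W|, whatever happened before; so the number of hits
   has a moment generating function below the binomial one. *)
Lemma perm_mgf (R : realFieldType) (T : finType) (W Z B : {set T}) (l z0 : R) (s : nat) :
  0 <= l <= 1 -> 0 <= z0 -> z0 + s%:R <= #|Z|%:R -> Z \subset W -> B \subset W ->
  (#|B| <= s)%N ->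
  \sum_(pi : perm_type T | perm_on W pi) l ^+ hits Z B pi <=
    (\sum_(pi : perm_type T | perm_on W pi) 1) * (1 - (1 - l) * z0 / #|W|%:R) ^+ #|B|.
Proof.
move=> /andP[l0 l1] z00 z0s ZW; have [k] := ubnP #|B|; elim: k B => // k IH B.
have [->|[b bB]] := set_0Vmem B.
  move=> _ _ _; rewrite cards0 expr0 mulr1; apply: ler_sum => pi _.
  by rewrite exprn_ile1 // l0.
rewrite ltnS => Bk BW Bs; pose C := B :\ b.
have bC : b \notin C by rewrite !inE eqxx.
have BE : B = b |: C by rewrite setD1K.
have cB : #|B| = #|C|.+1 by rewrite BE cardsU1 bC.
have CW : C \subset W by apply: subset_trans BW; rewrite subsetDl.
have bW := subsetP BW _ bB.
have cZW := subset_leq_card ZW.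
have cBW := subset_leq_card BW.
have cW0 : 0 < #|W|%:R :> R by rewrite ltr0n (leq_trans _ cBW) // cB.
set rho := 1 - _.
have rho0 : 0 <= rho.
  rewrite subr_ge0 ler_pdivrMr // mul1r.
  have : #|Z|%:R <= #|W|%:R :> R by rewrite ler_nat.
  have : 0 <= s%:R :> R by [].
  have : 0 <= l * z0 by rewrite mulr_ge0.
  lra.
rewrite cB exprS mulrCA.
have CIH : \sum_(pi : perm_type T | perm_on W pi) l ^+ hits Z C pi <=
    (\sum_(pi : perm_type T | perm_on W pi) 1) * rho ^+ #|C|.
  by apply: IH => //; [rewrite -cB|apply: ltnW; rewrite -cB].
suff step : \sum_(pi : perm_type T | perm_on W pi) l ^+ hits Z B pi <=
    rho * \sum_(pi : perm_type T | perm_on W pi) l ^+ hits Z C pi.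
  by apply: (le_trans step); rewrite ler_wpM2l.
set M := (#|W| - #|C|)%N.
have M0 : 0 < M%:R :> R by rewrite ltr0n /M subn_gt0 -cB.
rewrite -(ler_pM2l M0).
have cWC : #|W :\: C| = M by rewrite cardsD (setIidPr CW).
(* Conditioning is replaced by symmetry: composing with [tperm b c] shows that any [c] in [W]
   outside [C] can play the part of [b]. The sum is therefore averaged over all these [c]. *)
pose F (c : T) : R := \sum_(pi : perm_type T | perm_on W pi)
    l ^+ hits Z C pi * l ^+ (pi c \in Z).
have FE c : c \in W :\: C ->
    \sum_(pi : perm_type T | perm_on W pi) l ^+ hits Z B pi = F c.
  rewrite inE => /andP[cC cW].
  transitivity (F b).
    by apply: eq_bigr => pi _; rewrite BE hitsU1 // exprD.
  rewrite /F (reindex_inj (mulgI (tperm b c))) /=.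
  apply: eq_big => pi.
    have tW : perm_on W (tperm b c).
      apply/subsetP => x; rewrite inE; apply: contraNT => xW.
      by rewrite tpermD //; apply: contraNneq xW => <-.
    apply/idP/idP => H; last exact: perm_onM.
    by rewrite -[pi]mul1g -(tperm2 b c) -mulgA perm_onM.
  move=> _; congr (l ^+ _ * l ^+ _); last by rewrite permM tpermL.
  apply: eq_card => v; rewrite !inE permM.
  have [vC|//] := boolP ((v != b) && (v \in B)).
  rewrite tpermD //; apply/eqP => E; first by move: vC; rewrite -E eqxx.
  by move: cC vC; rewrite !inE -E => /negbTE->.
rewrite {1}(_ : M%:R = \sum_(c in W :\: C) 1); last by rewrite sumr_const cWC.
rewrite mulr_suml; under eq_bigr => c cWC' do rewrite mul1r (FE _ cWC').
rewrite exchange_big /= mulrA mulr_sumr; apply: ler_sum => pi piW.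
rewrite -mulr_sumr mulrC ler_wpM2r ?exprn_ge0 //.
pose Y := [set c in W :\: C | pi c \in Z].
have sumE : \sum_(c in W :\: C) l ^+ (pi c \in Z) = M%:R - (1 - l) * #|Y|%:R.
  transitivity (\sum_(c in W :\: C) (1 - (1 - l) * (pi c \in Z)%:R)).
    by apply: eq_bigr => c _; case: (pi c \in Z); rewrite /= ?expr1 ?expr0; ring.
  rewrite sumrB sumr_const cWC -mulr_sumr; congr (_ - _ * _).
  rewrite -natr_sum -sum1_card [in RHS](eq_bigl (fun c => (c \in W :\: C) && (pi c \in Z))).
    by rewrite big_mkcondr; congr (_%:R); apply: eq_bigr => c _; case: (_ \in Z).
  by move=> c; rewrite inE.
rewrite sumE.
(* The points of [C] use up at most [#|C|] elements of [Z], so at least [z0] remain to be hit. *)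
have cY : (#|Z| <= #|Y| + #|C|)%N.
  have <- : #|[set c | pi c \in Z]| = #|Z|.
    rewrite -(card_imset _ (@perm_inj _ pi)); apply: eq_card => v; apply/imsetP/idP.
      by case=> c; rewrite inE => ? ->.
    by move=> vZ; exists (pi^-1 v)%g; rewrite ?inE permKV.
  apply: leq_trans (leq_card_setU _ _); apply: subset_leq_card; apply/subsetP => c.
  rewrite !inE => pcZ; rewrite pcZ andbT.
  have -> : c \in W by rewrite -(perm_closed _ piW) (subsetP ZW).
  by rewrite andbT; case: (_ && _).
have : #|Z|%:R <= #|Y|%:R + #|C|%:R :> R by rewrite -natrD ler_nat.
have : #|C|%:R <= s%:R :> R by rewrite ler_nat ltnW // -cB.
have : M%:R <= #|W|%:R :> R by rewrite ler_nat leq_subr.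
rewrite /rho => h1 h2 h3.
have Y0 : z0 <= #|Y|%:R by lra.
have : (1 - l) * z0 <= (1 - l) * #|Y|%:R by rewrite ler_wpM2l // subr_ge0.
have : M%:R / #|W|%:R * ((1 - l) * z0) <= 1 * ((1 - l) * z0).
  by apply: ler_wpM2r; rewrite ?mulr_ge0 ?subr_ge0 // ler_pdivrMr // mul1r.
lra.
Qed.

(** A fixed equipartition is relabelled by a random permutation of [W]. If every permutation left
    some [Z j] with at most [k] elements in some class, that pair alone would contribute at least
    [l ^+ k], and the average over permutations would contradict the sum of the moment bounds. *)
Lemma balanced_partition (R : realFieldType) (T J : finType) (W : {set T})
    (Z : J -> {set T}) (m s k : nat) (l z0 : R) :
  #|W| = (m * s)%N -> 0 <= l <= 1 -> 0 <= z0 ->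
  (forall j, Z j \subset W) -> (forall j, z0 + s%:R <= #|Z j|%:R) ->
  (#|J| * m)%:R * (1 - (1 - l) * z0 / (m * s)%:R) ^+ s < l ^+ k ->
  exists ch : T -> nat, [/\ {in W, forall v, (ch v < m)%N},
    forall i, (i < m)%N -> #|[set v in W | ch v == i]| = s
    & forall j i, (i < m)%N -> (k < #|[set v in Z j | ch v == i]|)%N].
Proof.
move=> cW l01 z00 ZW cZ lt.
have [ch0 [ch0m ch0s]] := equipartition cW.
pose B (i : nat) := [set v in W | ch0 v == i].
have BW i : B i \subset W by apply/subsetP => v; rewrite inE => /andP[].
have cB i : (i < m)%N -> #|B i| = s by exact: ch0s.
have /existsP[pi /andP[piW /forallP H]] : [exists pi : perm_type T,
    perm_on W pi && [forall ji : J * 'I_m, (k < hits (Z ji.1) (B ji.2) pi)%N]].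
  apply: contraLR lt => /existsPn bad; rewrite -leNgt.
  pose N : R := \sum_(pi : perm_type T | perm_on W pi) 1.
  have N0 : 0 < N.
    rewrite /N (bigD1 (1%g : perm_type T)) ?perm_on1 //= ltr_wpDr //.
    by apply: sumr_ge0.
  rewrite -(ler_pM2l N0) /N mulr_suml.
  set rho := 1 - _.
  apply: (@le_trans _ _ (\sum_(pi : perm_type T | perm_on W pi)
      \sum_(ji : J * 'I_m) l ^+ hits (Z ji.1) (B ji.2) pi)).
    apply: ler_sum => pi piW; rewrite mul1r.
    have := bad pi; rewrite piW /= => /forallPn[ji]; rewrite -leqNgt => le.
    rewrite (bigD1 ji) //=; case/andP: l01 => l0 l1.
    apply: (@le_trans _ _ (l ^+ hits (Z ji.1) (B ji.2) pi)).
      by rewrite ler_wiXn2l.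
    by rewrite lerDl sumr_ge0 // => *; rewrite exprn_ge0.
  rewrite exchange_big /= -/N mulrCA -[(#|J| * m)%N](_ : #|{: J * 'I_m}| = _); last first.
    by rewrite card_prod card_ord.
  rewrite -sum1_card natr_sum mulr_suml; apply: ler_sum => -[j i] _ /=.
  have := perm_mgf l01 z00 (cZ j) (ZW j) (BW i); rewrite cB //.
  by rewrite /rho -cW mul1r; apply.
have cpi (X : {set T}) : #|[set pi v | v in X]| = #|X|.
  by rewrite card_imset //; exact: perm_inj.
have WV v : ((pi^-1)%g v \in W) = (v \in W).
  by rewrite -(perm_closed _ piW) permKV.
exists (fun v => ch0 ((pi^-1)%g v)); split=> [v vW|i im|j i im].
- by apply: ch0m; rewrite WV.
- rewrite -[RHS](cB _ im) -[RHS]cpi; apply: eq_card => v; rewrite inE -WV.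
  apply/idP/imsetP => [vB|[w wB ->]]; first by exists (pi^-1 v)%g; rewrite ?inE ?permKV.
  by rewrite permK; rewrite inE in wB.
- apply: leq_trans (H (j, Ordinal im)) _.
  rewrite /hits -[leqLHS]cpi; apply: subset_leq_card; apply/subsetP => v /imsetP[w].
  by rewrite !inE => /andP[/andP[_ ?] ?] ->; rewrite permK; apply/andP.
Qed.

(** * Robust Hamiltonicity of pseudorandom digraphs *)

Lemma sum_card_sym (T : finType) (e : rel T) (S X : {set T}) :
  (\sum_(x in X) #|[set y in S | e y x]| = \sum_(y in S) #|[set x in X | e y x]|)%N.
Proof.
under eq_bigr do rewrite -sum1_card; under [RHS]eq_bigr do rewrite -sum1_card.
rewrite (exchange_big_dep (mem S)) /=; last by move=> x y _; rewrite inE => /andP[].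
by apply: eq_bigr => y yS; apply: eq_bigl => x; rewrite !inE yS.
Qed.

(** Vertices with at most one neighbour in [S] absorb at most [#|T|] of the arcs at [S], which is
    negligible as [a * p * #|S|] is at least 16. Nearly all arcs thus go to those with two, and
    pseudorandomness makes these more than half of all vertices. Two neighbours rather than one
    leave room to keep paths simple. *)
Lemma big_second_nbhd (R : realFieldType) (T : finType) (e : rel T) (U S : {set T})
    (p a s : R) :
  0 < p -> 0 < a -> 0 <= s -> s <= #|S|%:R -> 16 <= a * p * #|S|%:R ->
  (0 < #|T|)%N ->
  (forall y, y \in S ->
    (1 / 2 + 5 / 8 * a) * (p * #|T|%:R) <= #|[set x in ~: U | e y x]|%:R) ->
  (forall X : {set T}, (\sum_(x in X) #|[set y in S | e y x]|)%:R <=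
     p * #|S|%:R * #|X|%:R + a / 16 * p * (#|T|%:R * #|S|%:R + s * #|X|%:R)) ->
  (#|T| < 2 * #|[set x in ~: U | (1 < #|[set y in S | e y x]|)%N]|)%N.
Proof.
move=> p0 a0 s0 sS aS T0 deg psr; set X := [set x in _ | _].
have n0 : 0 < #|T|%:R :> R by rewrite ltr0n.
have S0 : 0 < #|S|%:R :> R.
  by rewrite lt_neqAle ler0n andbT; apply/eqP => E; move: aS; rewrite -E mulr0; lra.
have upper : (\sum_(x in ~: U) #|[set y in S | e y x]| <=
    \sum_(x in X) #|[set y in S | e y x]| + #|T|)%N.
  rewrite (bigID (mem X)) /= leq_add //.
    by rewrite [leqLHS](eq_bigl (mem X)) // => x; rewrite !inE; case: (x \in U).
  apply: (@leq_trans (\sum_(x in ~: U | x \notin X) 1)).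
    apply: leq_sum => x /andP[xU]; rewrite inE xU /= -leqNgt; apply.
  by rewrite sum1dep_card max_card.
have lower : #|S|%:R * ((1 / 2 + 5 / 8 * a) * (p * #|T|%:R)) <=
    (\sum_(x in ~: U) #|[set y in S | e y x]|)%:R :> R.
  rewrite sum_card_sym natr_sum -[#|S|]sum1_card natr_sum mulr_suml.
  by apply: ler_sum => y yS; rewrite [leLHS]mul1r deg.
have : (\sum_(x in ~: U) #|[set y in S | e y x]|)%:R <=
   (\sum_(x in X) #|[set y in S | e y x]|)%:R + #|T|%:R :> R.
  by rewrite -natrD ler_nat.
have := psr X; set E1 := (\sum_(x in X) _)%:R; set E2 := (\sum_(x in ~: _) _)%:R in lower *.
move=> h1 h2; rewrite -(ltr_nat R) natrM.
have XT : #|X|%:R <= #|T|%:R :> R by rewrite ler_nat max_card.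
have h3 : s * #|X|%:R <= #|S|%:R * #|T|%:R by apply: ler_pM.
have h4 : a / 16 * p * (#|T|%:R * #|S|%:R + s * #|X|%:R) <=
          a / 16 * p * (2 * (#|S|%:R * #|T|%:R)).
  apply: ler_wpM2l; first by rewrite mulr_ge0 ?divr_ge0 // ltW.
  by rewrite [#|T|%:R * _]mulrC; lra.
have h5 : 16 * #|T|%:R <= a * p * #|S|%:R * #|T|%:R by rewrite ler_wpM2r.
rewrite ltNge; apply/negP => h6.
have h7 : p * #|S|%:R * (2 * #|X|%:R) <= p * #|S|%:R * #|T|%:R.
  by rewrite ler_wpM2l // mulr_ge0 // ltW.
have : 0 < a * (p * (#|S|%:R * #|T|%:R)) by rewrite !mulr_gt0.
set x := a * _ => x0.
have e1 : a * p * #|S|%:R * #|T|%:R = x by rewrite /x; ring.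
have e2 : a / 16 * p * (2 * (#|S|%:R * #|T|%:R)) = x / 8 by rewrite /x; field.
have e3 : #|S|%:R * ((1 / 2 + 5 / 8 * a) * (p * #|T|%:R)) =
   p * #|S|%:R * #|T|%:R / 2 + 5 / 8 * x by rewrite /x; field.
move: h5 h4 lower; rewrite e1 e2 e3 => h5 h4 lower.
lra.
Qed.

(** The side condition keeps the mean below [p] times the weight [A #|S| + B #|U|], so that an
    excess of [c p] times this weight is a large deviation. It holds automatically if [#|U| <= A] or
    [#|S| <= B]. *)
Definition pseudorandom (R : realFieldType) (T : finType) (D : {set T * T})
    (p c A B : R) :=
  forall S U : {set T},
    #|S|%:R * #|U|%:R <= A * #|S|%:R + B * #|U|%:R ->
    #|D :&: setX S U|%:R <= p * (#|S|%:R * #|U|%:R) + c * p * (A * #|S|%:R + B * #|U|%:R).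

(** The second out-neighbourhood of [v] and the second in-neighbourhood of [w], taken outside [U],
    both exceed [n / 2], so they share a vertex [x], the middle of the path. *)
Lemma links_exist (R : realFieldType) (n : nat) (D D0 : digraph n) (p a : R) (s M : nat) :
  D \subset D0 -> no_loop D -> 0 < p -> 0 < a ->
  (forall v, (1 / 2 + 3 / 4 * a) * (p * n%:R) <= (outdeg D v)%:R) ->
  (forall v, (1 / 2 + 3 / 4 * a) * (p * n%:R) <= (indeg D v)%:R) ->
  pseudorandom D0 p (a / 16) n%:R s%:R -> pseudorandom D0 p (a / 16) s%:R n%:R ->
  M%:R <= a / 8 * (p * n%:R) -> s%:R <= p * n%:R / 2 -> 32 <= a * p * (p * n%:R) ->
  links D M.
Proof.
move=> DD0 nl p0 a0 dout din ps1 ps2 Ma sa ha U v w cU vU wU.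
have n0 : 0 < n%:R :> R by rewrite ltr0n (leq_ltn_trans (leq0n v)) .
have pn0 : 0 < p * n%:R by rewrite mulr_gt0.
have apn0 : 0 < a * (p * n%:R) by rewrite mulr_gt0.
have UM : #|U|%:R <= a / 8 * (p * n%:R) :> R by apply: le_trans Ma; rewrite ler_nat.
have degU (X : {set 'I_n}) : (1 / 2 + 3 / 4 * a) * (p * n%:R) <= #|X|%:R ->
    (1 / 2 + 5 / 8 * a) * (p * n%:R) <= #|X :\: U|%:R.
  move=> h; have := cardsID U X => e; have : #|X|%:R <= #|X :\: U|%:R + #|U|%:R :> R.
    by rewrite -natrD ler_nat -e addnC leq_add2l subset_leq_card // subsetIr.
  lra.
pose S1 := [set x | (v, x) \in D] :\: U; pose S2 := [set x | (x, w) \in D] :\: U.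
have cS1 : (1 / 2 + 5 / 8 * a) * (p * n%:R) <= #|S1|%:R by apply: degU; apply: dout.
have cS2 : (1 / 2 + 5 / 8 * a) * (p * n%:R) <= #|S2|%:R by apply: degU; apply: din.
have big (S : {set 'I_n}) : (1 / 2 + 5 / 8 * a) * (p * n%:R) <= #|S|%:R ->
    s%:R <= #|S|%:R :> R /\ 16 <= a * p * #|S|%:R.
  move=> h; have h' : p * n%:R / 2 <= #|S|%:R by lra.
  split; first by lra.
  have : a * p * (p * n%:R / 2) <= a * p * #|S|%:R by rewrite ler_wpM2l // mulr_ge0 // ltW.
  lra.
have DS (S X : {set 'I_n}) : #|D :&: setX S X|%:R <= #|D0 :&: setX S X|%:R :> R.
  by rewrite ler_nat subset_leq_card // setSI.
have card_n : #|'I_n| = n by rewrite card_ord.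
have cn (S : {set 'I_n}) : #|S|%:R <= n%:R :> R by rewrite ler_nat; have := max_card (mem S); rewrite card_n.
pose X1 := [set x in ~: U | (1 < #|[set y in S1 | (y, x) \in D]|)%N].
pose X2 := [set x in ~: U | (1 < #|[set y in S2 | (x, y) \in D]|)%N].
have cX1 : (n < 2 * #|X1|)%N.
  have [b1 b2] := big _ cS1.
  suff: (#|'I_n| < 2 * #|X1|)%N by rewrite card_n.
  apply: (@big_second_nbhd R _ (fun y x => (y, x) \in D) U S1 p a s%:R) => //.
  - by rewrite card_n -(ltr0n R).
  - move=> y yS; rewrite card_n.
    rewrite (_ : [set x in ~: U | (y, x) \in D] = [set x | (y, x) \in D] :\: U).
      exact/degU/dout.
    by apply/setP => x; rewrite !inE.
  - move=> X; rewrite -card_arcs_in card_n -[p * _ * _]mulrA.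
    apply: le_trans (DS _ _) _; apply: ps1.
    rewrite mulrC (@le_trans _ _ (n%:R * #|S1|%:R)) ?ler_wpM2r //.
    by rewrite lerDl mulr_ge0.
have cX2 : (n < 2 * #|X2|)%N.
  have [b1 b2] := big _ cS2.
  suff: (#|'I_n| < 2 * #|X2|)%N by rewrite card_n.
  apply: (@big_second_nbhd R _ (fun y x => (x, y) \in D) U S2 p a s%:R) => //.
  - by rewrite card_n -(ltr0n R).
  - move=> y yS; rewrite card_n.
    rewrite (_ : [set x in ~: U | (x, y) \in D] = [set x | (x, y) \in D] :\: U).
      exact/degU/din.
    by apply/setP => x; rewrite !inE.
  - move=> X; rewrite -card_arcs_out card_n -mulrA [#|S2|%:R * _]mulrC [n%:R * _ + _]addrC.
    apply: le_trans (DS _ _) _; apply: ps2.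
    rewrite (@le_trans _ _ (n%:R * #|S2|%:R)) ?ler_wpM2r //.
    by rewrite lerDr mulr_ge0.
have [x] : exists x, x \in X1 :&: X2.
  apply/set0Pn; rewrite -card_gt0; have := cardsUI X1 X2.
  have := max_card (mem (X1 :|: X2)); rewrite card_n.
  clear -cX1 cX2; move: #|_| => c; lia.
rewrite !inE => /andP[/andP[xU x1] /andP[_ x2]].
have [z] : exists z, z \in [set y in S2 | (x, y) \in D].
  by apply/set0Pn; rewrite -card_gt0 (leq_trans _ x2).
rewrite !inE => /andP[/andP[zU zw] xz].
(* Of the two candidates between [v] and [x], at least one differs from the [z] already chosen. *)
have [y + yz] : exists2 y, y \in [set y in S1 | (y, x) \in D] & y != z.
  case/card_gt1P: x1 => [t1 [t2 [h1 h2 h12]]].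
  have [E|N] := eqVneq t1 z; last by exists t1.
  by exists t2 => //; rewrite -E eq_sym.
rewrite !inE => /andP[/andP[yU vy] yx].
exists [:: y; x; z]; split=> //=.
- rewrite !inE negb_or yz !andbT; apply/andP; split.
    by apply: contraTneq yx => ->; apply: nl.
  by apply: contraTneq xz => ->; apply: nl.
- by move=> t; rewrite !inE => /or3P[] /eqP->.
- by rewrite vy yx xz zw.
Qed.

(** The sets to be split evenly are the [2 * n] out- and in-neighbourhoods; with at most [n] classes
    this gives the factor [2 * n * n]. Since [m * s <= n], the sampling rate is at least [z]. *)
Lemma balanced_chunks (R : realFieldType) (n : nat) (D : digraph n) (W : {set 'I_n})
    (m s k : nat) (l z q : R) :
  #|W| = (m * s)%N -> 0 < l <= 1 -> 0 <= z -> (0 < n)%N ->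
  (forall v, z * n%:R + s%:R <= #|[set w in W | (v, w) \in D]|%:R) ->
  (forall v, z * n%:R + s%:R <= #|[set w in W | (w, v) \in D]|%:R) ->
  (2 * n * n)%:R * (1 - (1 - l) * z) ^+ s < l ^+ k ->
  q <= k.+1%:R ->
  exists ch : 'I_n -> nat, [/\ {in W, forall v, (ch v < m)%N},
    forall i, (i < m)%N -> #|[set v in W | ch v == i]| = s
    & forall i v, (i < m)%N ->
        q <= #|[set w in [set w in W | ch w == i] | (v, w) \in D]|%:R /\
        q <= #|[set w in [set w in W | ch w == i] | (w, v) \in D]|%:R].
Proof.
move=> cW /andP[l0 l1] z0 n0 dout din lt qk.
pose Z (j : bool * 'I_n) :=
  [set w in W | if j.1 then (j.2, w) \in D else (w, j.2) \in D].
have n0R : 0 < n%:R :> R by rewrite ltr0n.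
have cWn : (m * s <= n)%N by rewrite -cW -[X in (_ <= X)%N](card_ord n) max_card.
have ZW j : Z j \subset W by apply/subsetP => w; rewrite inE => /andP[].
have cZ j : z * n%:R + s%:R <= #|Z j|%:R.
  by case: j => -[] v; [apply: dout | apply: din].
have zms : z * n%:R + s%:R <= (m * s)%:R.
  apply: le_trans (cZ (true, Ordinal n0)) _.
  by rewrite ler_nat -cW subset_leq_card.
(* An empty [W] forces [s = 0], and the tail hypothesis would read [2 * n * n < l ^+ k <= 1]. *)
have [m0|m0] := posnP (m * s).
  have : s = 0%N /\ z = 0.
    move: zms; rewrite m0 => zms; split.
      apply/eqP; rewrite -leqn0 -(ler_nat R); apply: le_trans zms.
      by rewrite lerDr mulr_ge0.
    apply/eqP; rewrite eq_le z0 andbT -(ler_pM2r n0R) mul0r.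
    by apply: le_trans zms; rewrite lerDl.
  case=> s0 z00; exists (fun=> 0%N); split.
  - by move=> v; move/eqP: cW; rewrite m0 cards_eq0 => /eqP->; rewrite inE.
  - move=> i _; move/eqP: cW; rewrite m0 cards_eq0 s0 => /eqP->.
    by rewrite (_ : [set _ in _ | _] = set0) ?cards0 //; apply/setP => v; rewrite !inE.
  - move: lt; rewrite s0 expr0 mulr1 => lt; exfalso.
    have : l ^+ k <= 1 by rewrite exprn_ile1 // ltW.
    have : 1 <= (2 * n * n)%:R :> R by rewrite ler1n !muln_gt0 n0.
    lra.
have ms0 : 0 < (m * s)%:R :> R by rewrite ltr0n.
have mn : (m <= n)%N by apply: leq_trans cWn; rewrite leq_pmulr //; move: m0; rewrite muln_gt0 => /andP[].
have lz0 : 0 <= l * z by rewrite mulr_ge0 // ltW.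
have s0R : 0 <= s%:R :> R by [].
have z1 : z <= 1.
  rewrite -(ler_pM2r n0R) mul1r; apply: (@le_trans _ _ (m * s)%:R); last by rewrite ler_nat.
  lra.
have rho0 : 0 <= 1 - (1 - l) * (z * n%:R) / (m * s)%:R.
  rewrite subr_ge0 ler_pdivrMr // mul1r.
  have : 0 <= l * (z * n%:R) by rewrite !mulr_ge0 // ltW.
  lra.
have l01 : 0 <= l <= 1 by rewrite ltW.
have zn0 : 0 <= z * n%:R by rewrite mulr_ge0.
have [|ch [chm chs chZ]] := balanced_partition (k := k) cW l01 zn0 ZW cZ.
  rewrite card_prod card_bool card_ord; apply: le_lt_trans lt.
  apply: ler_pM => //; first by rewrite exprn_ge0.
    by rewrite ler_nat leq_mul.
  apply: lerXn2r; rewrite ?nnegrE //; first by lra.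
  rewrite lerD2l lerN2 ler_pdivlMr // -mulrA ler_wpM2l ?subr_ge0 //.
  by rewrite ler_wpM2l // ler_nat.
exists ch; split=> // i v im; split.
- apply: le_trans qk _; rewrite ler_nat; apply: leq_trans (chZ (true, v) _ im) _.
  by apply: subset_leq_card; apply/subsetP => w; rewrite !inE /= => /andP[/andP[-> ->] ->].
- apply: le_trans qk _; rewrite ler_nat; apply: leq_trans (chZ (false, v) _ im) _.
  by apply: subset_leq_card; apply/subsetP => w; rewrite !inE /= => /andP[/andP[-> ->] ->].
Qed.

(** The ladder has fewer than [12 * s] vertices, and [14 * s] bounds all forbidden sets. Rungs use
    [d = s + 1], whose square exceeds [n]. Discarding [12 * s] vertices lowers the degree density
    from [1/2 + 3a/4] to no less than [1/2 + a/2], and sampling lowers it to [1/2 + a/4], enough for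
    matchings with error [a/16]. *)
Lemma robust_hamiltonian (R : realFieldType) (n : nat) (D D0 : digraph n)
    (p a l : R) (s k : nat) :
  D \subset D0 -> no_loop D -> 0 < p -> 0 < a -> (0 < s)%N -> (0 < n)%N ->
  (forall v, (1 / 2 + 3 / 4 * a) * (p * n%:R) <= (outdeg D v)%:R) ->
  (forall v, (1 / 2 + 3 / 4 * a) * (p * n%:R) <= (indeg D v)%:R) ->
  pseudorandom D0 p (a / 16) n%:R s%:R -> pseudorandom D0 p (a / 16) s%:R n%:R ->
  pseudorandom D0 p (a / 16) s%:R s%:R ->
  (n < s.+1 * s.+1)%N -> 16 * s%:R <= a / 8 * (p * n%:R) -> a <= 1 ->
  32 <= a * p * (p * n%:R) ->
  0 < l <= 1 -> (1 / 2 + a / 4) * (p * s%:R) <= k.+1%:R ->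
  (2 * n * n)%:R * (1 - (1 - l) * ((1 / 2 + a / 2) * p)) ^+ s < l ^+ k ->
  hamiltonian D.
Proof.
move=> DD0 nl p0 a0 s0 n0 dout din ps1 ps2 ps3 ns2 sa a1 ha l01 qk lt.
have n0R : 0 < n%:R :> R by rewrite ltr0n.
have s0R : 1 <= s%:R :> R by rewrite ler1n.
have pn0 : 0 < p * n%:R by rewrite mulr_gt0.
have apn : a * (p * n%:R) <= p * n%:R by rewrite ger_pMl.
have apn0 : 0 < a * (p * n%:R) by rewrite mulr_gt0.
have degn (X : {set 'I_n}) : (1 / 2 + 3 / 4 * a) * (p * n%:R) <= #|X|%:R -> (64 * s <= #|X|)%N.
  by move=> h; rewrite -(ler_nat R) natrM; lra.
have lks : links D (14 * s).
  apply: (links_exist DD0 nl p0 a0 dout din ps1 ps2) => //; last by lra.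
  by rewrite natrM; lra.
have rgs : rungs D (14 * s).
  move=> U u cU uU; apply: (@rung_exists _ D U u s.+1) => //.
  - by rewrite card_ord.
  - by move=> v; apply: leq_trans (degn _ (dout v)); clear -cU s0; lia.
  - by move=> v; apply: leq_trans (degn _ (din v)); clear -cU s0; lia.
pose z := (1 / 2 + a / 2) * p.
have z0 : 0 <= z by rewrite mulr_ge0 ?ltW //; lra.
pose q := (1 / 2 + a / 4) * (p * s%:R).
have chunks (W : {set 'I_n}) m : #|W| = (m * s)%N -> (#|~: W| <= 12 * s)%N ->
  exists ch : 'I_n -> nat, [/\ {in W, forall v, (ch v < m)%N},
    forall i, (i < m)%N -> #|[set v in W | ch v == i]| = s
    & forall i v, (i < m)%N ->
        q <= #|[set w in [set w in W | ch w == i] | (v, w) \in D]|%:R /\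
        q <= #|[set w in [set w in W | ch w == i] | (w, v) \in D]|%:R].
  move=> cW cWC.
  have dW (X : {set 'I_n}) : (1 / 2 + 3 / 4 * a) * (p * n%:R) <= #|X|%:R ->
      z * n%:R + s%:R <= #|W :&: X|%:R.
    move=> h; have : (#|X| <= #|W :&: X| + 12 * s)%N.
      rewrite -(cardsID W X) (setIC X) leq_add2l (leq_trans _ cWC) //.
      by apply: subset_leq_card; apply/subsetP => v; rewrite !inE => /andP[].
    by rewrite -(ler_nat R) natrD natrM /z; lra.
  have dO v : z * n%:R + s%:R <= #|[set w in W | (v, w) \in D]|%:R.
    rewrite (_ : [set _ in W | _] = W :&: [set w | (v, w) \in D]); last by apply/setP => w; rewrite !inE.
    exact/dW/dout.
  have dI v : z * n%:R + s%:R <= #|[set w in W | (w, v) \in D]|%:R.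
    rewrite (_ : [set _ in W | _] = W :&: [set w | (w, v) \in D]); last by apply/setP => w; rewrite !inE.
    exact/dW/din.
  exact: (balanced_chunks cW l01 z0 n0 dO dI lt qk).
have n64 : (64 * s <= n)%N.
  apply: leq_trans (degn _ (dout (Ordinal n0))) _.
  by have := max_card (mem [set w | (Ordinal n0, w) \in D]); rewrite card_ord.
pose good (X : {set 'I_n}) := #|X| = s /\ forall v,
   q <= #|[set w in X | (v, w) \in D]|%:R /\ q <= #|[set w in X | (w, v) \in D]|%:R.
have [A [B [gA gB dAB]]] : exists A B, [/\ good A, good B & [disjoint A & B]].
  (* [A] and [B] are the first two classes of a partition of all but [n %% s] vertices. *)
  have [|W _ cW] := @subset_of_size _ [set: 'I_n] (n %/ s * s).
    by rewrite cardsT card_ord leq_trunc_div.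
  have [|ch [_ chs chd]] := chunks _ _ cW.
    have := cardsC W; rewrite card_ord cW => E; have F := divn_eq n s.
    have {E F} -> : #|~: W| = (n %% s)%N by apply: (@addnI (n %/ s * s)%N); rewrite E.
    by apply: leq_trans (ltnW _) (leq_pmull s _); rewrite ?ltn_mod.
  have m1 : (1 < n %/ s)%N by rewrite leq_divRL //; clear -n64; lia.
  exists [set w in W | ch w == 0%N], [set w in W | ch w == 1%N]; split.
  - by split=> [|v]; [apply: chs; apply: ltnW | apply: chd; apply: ltnW].
  - by split=> [|v]; [apply: chs | apply: chd].
  - by rewrite disjoint_subset; apply/subsetP => v; rewrite !inE => /andP[-> /eqP->].
(* With padding [r] the ladder has [11 * s - 6 + r] vertices, which leaves exactly [m * s]. *)
pose r := ((n - (11 * s - 6)) %% s)%N; pose m := ((n - (11 * s - 6)) %/ s)%N.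
have rs : (r < s)%N by rewrite ltn_mod.
have mr : (n - (11 * s - 6) = m * s + r)%N by apply: divn_eq.
have [|L [K [g [ps [lad BK cL]]]]] := ladder_between (r := r) rgs lks dAB s0 gA.1 gB.1.
  by clear -rs; lia.
have cW : #|~: L| = (m * s)%N.
  have := cardsC L; rewrite card_ord cL; clear -mr n64 s0; lia.
have [|ch [chm chs chd]] := chunks _ _ cW.
  by rewrite setCK cL; clear -rs; lia.
have lay j : (j <= m.+1)%N -> good (layer L A B ch m j).
  rewrite /layer; case: j => [|j] //=; rewrite ltnS eqSS.
  case: eqVneq => //= jm jm'; have {jm jm'} jm : (j < m)%N by rewrite ltn_neqAle jm.
  by split=> [|v]; [apply: chs | apply: chd].
have [u0 u0A] : exists u0, u0 \in A by apply/set0Pn; rewrite -card_gt0 gA.1.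
have [|v vL|j jm|t [tD t1]] := layers_one_cycle (ch := ch) (m := m) (u0 := u0) lad BK.
- exact: (subsetP (ladder_inS lad)).
- by apply: chm; rewrite inE.
- have [g1 g2] := lay j (leqW jm); have [h1 h2] := lay j.+1 jm.
  apply: (pseudorandom_matching (b := a / 4) (c := a / 16) DD0 g1 h1 p0).
  + by rewrite divr_ge0 // ltW.
  + lra.
  + by move=> v _; apply: (h2 v).1.
  + by move=> v _; apply: (g2 v).2.
  + move=> S U cS cU; rewrite -[p * _ * _]mulrA natrD (mulrA _ p) -mulrA mulrDr.
    apply: ps3.
    rewrite (@le_trans _ _ (s%:R * #|U|%:R)) ?ler_wpM2r ?ler_nat //.
    by rewrite lerDr mulr_ge0.
exact: one_cycle_hamiltonian tD t1.
Qed.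

(** * The random digraph *)

From mathcomp Require Import all_classical all_reals all_analysis.
Import Order.TTheory GRing.Theory Num.Theory.

Definition dweight {R : realType} (n : nat) (p : R) (A : digraph n) : R :=
  p ^+ #|A| * (1 - p) ^+ (#|all_arcs n| - #|A|)%N.

(** Independence of the arcs: the sum is the expansion of a product over ordered pairs. *)
Lemma dweight_mgf (R : realType) (n : nat) (p l : R) (Q : digraph n) :
  Q \subset all_arcs n ->
  \sum_(A : digraph n | A \subset all_arcs n) dweight p A * l ^+ #|A :&: Q| =
  (1 + p * (l - 1)) ^+ #|Q|.
Proof.
move=> QN; set N := all_arcs n.
(* [F] is the factor of a present pair and [G] that of an absent one. Loops get 0 and 1, which
   removes every set not contained in [all_arcs n]. *)
pose F (x : 'I_n * 'I_n) : R := if x \in N then p * (if x \in Q then l else 1) else 0.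
pose G (x : 'I_n * 'I_n) : R := if x \in N then 1 - p else 1.
have pc (A B : digraph n) (c : R) : A \subset B ->
    \prod_(x in B) (if x \in A then c else 1) = c ^+ #|A|.
  move=> AB; rewrite -big_mkcondr /= -prodr_const; apply: eq_bigl => x.
  by apply: andb_idl; apply: (fintype.subsetP AB).
transitivity (\prod_x (F x + G x)); last first.
  rewrite (bigID (mem N)) /= [X in _ * X]big1 ?mulr1; last first.
    by move=> x xN; rewrite /F /G (negbTE xN) add0r.
  rewrite -(pc _ _ _ QN); apply: eq_bigr => x xN; rewrite /F /G xN.
  by case: ifP => _; ring.
rewrite bigA_distr [RHS](bigID (fun A : digraph n => A \subset N)) /=.
rewrite [X in _ = _ + X]big1 ?addr0; last first.
  move=> A /fintype.subsetPn[x xA xN]; rewrite (bigD1 x) //= xA /F (negbTE xN).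
  by rewrite mul0r.
apply: eq_big => [A|A AN]; first by [].
rewrite (bigID (mem N)) /= [X in _ = _ * X]big1 ?mulr1; last first.
  move=> x xN; rewrite ifF /G ?(negbTE xN) //.
  by apply: contraNF xN; apply: (fintype.subsetP AN).
rewrite /dweight -(pc _ _ p AN) -(pc (A :&: Q) N l); last first.
  by rewrite finset.subIset // AN.
have -> : (#|N| - #|A|)%N = #|N :\: A| by rewrite finset.cardsD (finset.setIidPr AN).
rewrite -(pc (N :\: A) N) ?finset.subsetDl // -!big_split; apply: eq_bigr => x xN /=.
by rewrite finset.in_setI finset.in_setD /F /G xN andbT; case: (x \in A) => /=; rewrite ?mulr1 ?mul1r.
Qed.

Lemma Dnp_probE (R : realType) (n : nat) (p : R) (E : digraph n -> bool) :
  Dnp_prob p E = \sum_(A : digraph n | A \subset all_arcs n) dweight p A * (E A)%:R.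
Proof. by []. Qed.

Lemma dweight_ge0 (R : realType) (n : nat) (p : R) (A : digraph n) :
  0 <= p <= 1 -> 0 <= dweight p A.
Proof. by move=> /andP[p0 p1]; rewrite mulr_ge0 ?exprn_ge0 ?subr_ge0. Qed.

Lemma sum_dweight (R : realType) (n : nat) (p : R) :
  \sum_(A : digraph n | A \subset all_arcs n) dweight p A = 1.
Proof.
have := dweight_mgf (n := n) p 1 (finset.sub0set _); rewrite cards0 expr0 => <-.
by apply: eq_bigr => A _; rewrite expr1n mulr1.
Qed.

Lemma Dnp_probC (R : realType) (n : nat) (p : R) (E : digraph n -> bool) :
  Dnp_prob p E = 1 - Dnp_prob p (fun A => ~~ E A).
Proof.
rewrite -(sum_dweight n p) !Dnp_probE -sumrB; apply: eq_bigr => A _.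
by case: (E A); rewrite /= ?mulr0 ?mulr1 ?subr0 ?subrr.
Qed.

Lemma Dnp_prob_markov (R : realType) (n : nat) (p : R) (E : digraph n -> bool)
    (f : digraph n -> R) :
  0 <= p <= 1 -> (forall A, 0 <= f A) -> (forall A, E A -> 1 <= f A) ->
  Dnp_prob p E <= \sum_(A : digraph n | A \subset all_arcs n) dweight p A * f A.
Proof.
move=> p01 f0 f1; apply: ler_sum => A _.
apply: ler_wpM2l; first exact: dweight_ge0.
by have := f1 A; case: (E A) => //= ->.
Qed.

Lemma Dnp_prob_le (R : realType) (n : nat) (p : R) (E F : digraph n -> bool) :
  0 <= p <= 1 -> (forall A : digraph n, A \subset all_arcs n -> E A -> F A) ->
  Dnp_prob p E <= Dnp_prob p F.
Proof.
move=> p01 EF; apply: ler_sum => A AN; apply: ler_wpM2l; first exact: dweight_ge0.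
by rewrite ler_nat; have := EF A AN; case: (E A) => // ->.
Qed.

Lemma Dnp_prob_ge0 (R : realType) (n : nat) (p : R) (E : digraph n -> bool) :
  0 <= p <= 1 -> 0 <= Dnp_prob p E.
Proof. by move=> p01; apply: sumr_ge0 => A _; rewrite mulr_ge0 ?dweight_ge0. Qed.

Lemma Dnp_prob_or (R : realType) (n : nat) (p : R) (E F : digraph n -> bool) :
  0 <= p <= 1 ->
  Dnp_prob p (fun A => E A || F A) <= Dnp_prob p E + Dnp_prob p F.
Proof.
move=> p01; rewrite -big_split; apply: ler_sum => A _ /=; rewrite -mulrDr.
apply: ler_wpM2l; first exact: dweight_ge0.
by rewrite -natrD ler_nat; case: (E A); case: (F A).
Qed.

Lemma Dnp_prob_exists (R : realType) (n : nat) (p : R) (J : finType)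
    (E : J -> digraph n -> bool) :
  0 <= p <= 1 ->
  Dnp_prob p (fun A => [exists j, E j A]) <= \sum_j Dnp_prob p (E j).
Proof.
move=> p01; rewrite exchange_big; apply: ler_sum => A _ /=; rewrite -mulr_sumr.
apply: ler_wpM2l; first exact: dweight_ge0.
case: existsP => [[j Ej]|_]; last by apply: sumr_ge0.
by rewrite (bigD1 j) //= Ej lerDl sumr_ge0.
Qed.

(** * Tail bounds for arc counts *)

Lemma expR_le_quad (R : realType) (t : R) : t <= 1 / 2 -> expR t <= 1 + t + 2 * t ^+ 2.
Proof.
(* From [expR (- t) >= 1 - t] follows [expR t <= 1 / (1 - t)], and the quadratic times [1 - t]
   equals [1 + t ^+ 2 * (1 - 2 * t)], at least 1. *)
move=> t2; have h : 1 - t <= expR (- t) by have := expR_ge1Dx (- t).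
have e0 := expR_gt0 t.
have e1 : expR t * expR (- t) = 1 by rewrite -expRD subrr expR0.
have h1 : expR t * (1 - t) <= 1 by rewrite -[leRHS]e1 ler_wpM2l // ltW.
have t1 : 0 < 1 - t by lra.
rewrite -(ler_pM2r t1); apply: le_trans h1 _.
have : 0 <= t ^+ 2 * (1 - 2 * t) by rewrite mulr_ge0 ?sqr_ge0 //; lra.
rewrite !expr2; lra.
Qed.

(* Both tails at once: t > 0 gives the upper tail and t < 0 the lower one. *)
Lemma arc_tail (R : realType) (n : nat) (p t x : R) (Q : digraph n) :
  0 <= p <= 1 -> t <= 1 / 2 -> Q \subset all_arcs n ->
  Dnp_prob p (fun A : digraph n => t * x <= t * #|A :&: Q|%:R) <=
  expR (- t * x + p * #|Q|%:R * (t + 2 * t ^+ 2)).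
Proof.
move=> p01 t2 QN; have /andP[p0 p1] := p01.
have := @Dnp_prob_markov R n p (fun A => t * x <= t * #|A :&: Q|%:R)
  (fun A => expR (t * #|A :&: Q|%:R - t * x)) p01.
move/(_ (fun A => expR_ge0 _)) => H; apply: (le_trans (H _)).
  by move=> A h; rewrite -[leLHS]expR0 ler_expR subr_ge0.
have E (A : digraph n) : dweight p A * expR (t * #|A :&: Q|%:R - t * x) =
    expR (- t * x) * (dweight p A * expR t ^+ #|A :&: Q|).
  by rewrite expRD -mulNr [t * _]mulrC expRM_natl; ring.
under eq_bigr => A _ do rewrite E.
rewrite -mulr_sumr dweight_mgf // expRD mulNr ler_wpM2l ?expR_ge0 //.
have -> : p * #|Q|%:R * (t + 2 * t ^+ 2) = #|Q|%:R * (p * (t + 2 * t ^+ 2)) by ring.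
rewrite expRM_natl; apply: lerXn2r; rewrite ?nnegrE ?expR_ge0 //.
  have : 0 <= p * expR t by rewrite mulr_ge0 ?expR_ge0.
  lra.
apply: le_trans (expR_ge1Dx _); rewrite lerD2l ler_wpM2l //.
by have := expR_le_quad t2; lra.
Qed.

Lemma rect_tail (R : realType) (n : nat) (p t x : R) (S U : {set 'I_n}) :
  0 <= p <= 1 -> t <= 1 / 2 ->
  Dnp_prob p (fun A : digraph n => t * x <= t * #|A :&: finset.setX S U|%:R) <=
  expR (- t * x + p * #|finset.setX S U :&: all_arcs n|%:R * (t + 2 * t ^+ 2)).
Proof.
move=> p01 t2; set Q := _ :&: all_arcs n.
have QN : Q \subset all_arcs n by apply: finset.subsetIr.
apply: le_trans (arc_tail x p01 t2 QN); apply: Dnp_prob_le => // A AN.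
suff -> : A :&: finset.setX S U = A :&: Q by [].
by rewrite /Q finset.setIA finset.setIAC (finset.setIidPl AN).
Qed.

Lemma sum_subsets (R : realType) (T : finType) (y : R) :
  \sum_(S : {set T}) y ^+ #|S| = (1 + y) ^+ #|T|.
Proof.
rewrite -prodr_const addrC bigA_distr; apply: eq_big => // S _.
rewrite -big_mkcond /= -prodr_const; apply: eq_bigl => x.
by [].
Qed.

(* The pair (S, U) fails with probability at most y ^ (#|S| + #|U|), where y is the
   exponential below, and these weights sum to (1 + y) ^ (2 n); the pair of empty
   sets never fails. *)
Lemma pseudorandom_prob (R : realType) (n : nat) (p c A B s : R) :
  0 <= p <= 1 -> 0 < c <= 2 -> 0 <= s -> s <= A -> s <= B ->
  Dnp_prob p (fun D : digraph n => ~~ `[< pseudorandom D p c A B >]) <=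
  (1 + expR (- (c ^+ 2 / 8 * p * s))) ^+ (2 * n) - 1.
Proof.
move=> p01 /andP[c0 c2] s0 sA sB; have /andP[p0 p1] := p01.
set y := expR _.
pose J := ({set 'I_n} * {set 'I_n})%type.
pose W (j : J) : R := A * #|j.1|%:R + B * #|j.2|%:R.
pose bad (j : J) (D : digraph n) : bool := (#|j.1|%:R * #|j.2|%:R <= W j) &&
  (p * (#|j.1|%:R * #|j.2|%:R) + c * p * W j < #|D :&: finset.setX j.1 j.2|%:R).
apply: (@le_trans _ _ (Dnp_prob p (fun D => [exists j, bad j D]))).
  apply: Dnp_prob_le => // D _; apply: contraNT => /existsPn H.
  apply/asboolP => S U h; rewrite leNgt; have := H (S, U).
  by rewrite /bad /W /= h.
apply: (le_trans (Dnp_prob_exists _ p01)).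
have W0 j : 0 <= W j by rewrite addr_ge0 // mulr_ge0 //; lra.
have yE (k : nat) : y ^+ k = expR (- (c ^+ 2 / 8 * p * s) * k%:R).
  by rewrite /y -expRM_natl mulrC.
have bj j : Dnp_prob p (bad j) <= y ^+ (#|j.1| + #|j.2|).
  have [h|h] := boolP (#|j.1|%:R * #|j.2|%:R <= W j); last first.
    apply: (@le_trans _ _ 0); last by rewrite exprn_ge0 ?expR_ge0.
    rewrite Dnp_probE big1 // => D _.
    by rewrite /bad (negbTE h) mulr0.
  pose x := p * (#|j.1|%:R * #|j.2|%:R) + c * p * W j.
  (* The tilt [t = c / 4] gives an exponent of at most [- c^2 p W / 4 + c^2 p W / 8], the mean being
     at most [p W]; and [W] is at least [s] times the total size. *)
  have t2 : c / 4 <= 1 / 2 by lra.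
  have := rect_tail x j.1 j.2 p01 t2; set q := #|_ :&: _|%:R => H.
  have qle : q <= #|j.1|%:R * #|j.2|%:R.
    rewrite /q -natrM -cardsX ler_nat; apply: subset_leq_card; exact: finset.subsetIl.
  apply: le_trans (le_trans H _).
    apply: Dnp_prob_le => // D _ /andP[_] /ltW.
    by rewrite ler_pM2l //; lra.
  rewrite yE ler_expR natrD /x.
  have sW : s * (#|j.1|%:R + #|j.2|%:R) <= W j.
    by rewrite mulrDr /W lerD // ler_wpM2r.
  have k0 : 0 <= c ^+ 2 / 8 * p by rewrite mulr_ge0 // divr_ge0 ?sqr_ge0.
  have e1 : p * q * (c / 4 + 2 * (c / 4) ^+ 2) <=
      p * (#|j.1|%:R * #|j.2|%:R) * (c / 4 + 2 * (c / 4) ^+ 2).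
    by rewrite ler_wpM2r ?ler_wpM2l // addr_ge0 ?mulr_ge0 ?sqr_ge0 //; lra.
  have e2 : c ^+ 2 / 8 * p * (s * (#|j.1|%:R + #|j.2|%:R)) <= c ^+ 2 / 8 * p * W j.
    by apply: ler_wpM2l.
  have e3 : c ^+ 2 / 8 * p * (#|j.1|%:R * #|j.2|%:R) <= c ^+ 2 / 8 * p * W j.
    by apply: ler_wpM2l.
  rewrite !expr2 in e1 e2 e3 *; lra.
rewrite (bigD1 (finset.set0, finset.set0)) //= [X in X + _](_ : _ = 0) ?add0r; last first.
  rewrite Dnp_probE big1 // => D _; rewrite /bad /W /= !cards0 !mulr0 !addr0 !mulr0.
  rewrite (_ : _ :&: _ = finset.set0) ?cards0 ?addr0 ?ltxx ?andbF ?mulr0 //.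
  by apply/finset.setP => -[v w]; rewrite finset.in_setI finset.in_setX !finset.in_set0 !andbF.
apply: le_trans (ler_sum _ (fun j _ => bj j)) _.
have E : \sum_(j : J) y ^+ (#|j.1| + #|j.2|) = (1 + y) ^+ (2 * n).
  under eq_bigr do rewrite exprD.
  rewrite -(pair_bigA _ (fun S U : {set 'I_n} => y ^+ #|S| * y ^+ #|U|)) /=.
  under eq_bigr do rewrite -mulr_sumr.
  by rewrite -mulr_suml sum_subsets card_ord -exprD mul2n addnn.
by rewrite -E [X in _ <= X - 1](bigD1 (finset.set0, finset.set0)) //= !cards0 expr0 addrAC subrr add0r.
Qed.

Lemma low_degree_prob (R : realType) (n : nat) (p a : R) (f : 'I_n -> digraph n -> nat)
    (S U : 'I_n -> {set 'I_n}) :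
  0 <= p <= 1 -> 0 < a <= 1 -> 16 <= a * n%:R ->
  (forall v A, f v A = #|A :&: finset.setX (S v) (U v)|) ->
  (forall v, #|finset.setX (S v) (U v) :&: all_arcs n| = n.-1) ->
  Dnp_prob p (fun A : digraph n => [exists v, (f v A)%:R < (1 - a / 4) * (p * n%:R)]) <=
  n%:R * expR (- (a ^+ 2 / 256 * p * n%:R)).
Proof.
move=> p01 /andP[a0 a1] an fE qE; have /andP[p0 p1] := p01.
apply: (le_trans (Dnp_prob_exists _ p01)).
rewrite [leRHS](_ : _ = \sum_(v < n) expR (- (a ^+ 2 / 256 * p * n%:R))); last first.
  by rewrite sumr_const card_ord mulr_natl.
apply: ler_sum => v _.
(* The tilt [- a / 32] yields the constant 256. There are only [n - 1] possible arcs at a vertex;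
   [16 <= a * n] absorbs the missing one. *)
have t2 : - (a / 32) <= 1 / 2 by lra.
have := rect_tail ((1 - a / 4) * (p * n%:R)) (S v) (U v) p01 t2; rewrite qE => H.
apply: le_trans (le_trans H _).
  apply: Dnp_prob_le => // A _ /ltW; rewrite fE => h.
  by rewrite !mulNr lerN2 ler_pM2l //; lra.
have n0 : (0 < n)%N by case: (n) an => //; rewrite mulr0; lra.
rewrite ler_expR -subn1 natrB //.
have pa : 0 <= p * (a * n%:R - 16) by rewrite mulr_ge0 // subr_ge0.
have apa : 0 <= a * (p * (a * n%:R - 16)) by rewrite mulr_ge0 // ltW.
have ap : 0 <= a ^+ 2 * p by rewrite mulr_ge0 ?sqr_ge0.
have apn : 0 <= a ^+ 2 * p * n%:R by rewrite mulr_ge0.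
rewrite !expr2 in ap apn *; lra.
Qed.

Lemma high_degree_prob (R : realType) (n : nat) (p a : R) (X : {set 'I_n})
    (f : 'I_n -> digraph n -> nat) (S U : 'I_n -> {set 'I_n}) :
  0 <= p <= 1 -> 0 < a <= 1 ->
  (forall v A, f v A = #|A :&: finset.setX (S v) (U v)|) ->
  (forall v, v \in X -> (2 * #|finset.setX (S v) (U v) :&: all_arcs n| <= n)%N) ->
  Dnp_prob p (fun A : digraph n =>
    [exists v, (v \in X) && ((1 / 2 + a) * (p * n%:R) < (f v A)%:R)]) <=
  n%:R * expR (- (a ^+ 2 / 256 * p * n%:R)).
Proof.
move=> p01 /andP[a0 a1] fE qE; have /andP[p0 p1] := p01.
apply: (le_trans (Dnp_prob_exists _ p01)).
rewrite [leRHS](_ : _ = \sum_(v < n) expR (- (a ^+ 2 / 256 * p * n%:R))); last first.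
  by rewrite sumr_const card_ord mulr_natl.
apply: ler_sum => v _.
have [vX|vX] := boolP (v \in X); last first.
  apply: (@le_trans _ _ 0); last exact: expR_ge0.
  by rewrite Dnp_probE big1 // => A _; rewrite mulr0.
(* This tilt gives the exponent [- a^2 p n / 4]; it is weakened to the constant of the lower
   tail. *)
have t2 : a / 2 <= 1 / 2 by lra.
have := rect_tail ((1 / 2 + a) * (p * n%:R)) (S v) (U v) p01 t2.
have := qE v vX; rewrite -(ler_nat R) natrM; set q := #|_ :&: _|%:R => qn H.
apply: le_trans (le_trans H _).
  apply: Dnp_prob_le => // A _ /andP[_ /ltW]; rewrite fE => h.
  by rewrite ler_pM2l //; lra.
rewrite ler_expR.
have c0 : 0 <= a / 2 + 2 * (a / 2) ^+ 2 by rewrite addr_ge0 ?mulr_ge0 ?sqr_ge0 //; lra.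
have pq : p * q <= p * (n%:R / 2) by rewrite ler_wpM2l //; lra.
have := ler_wpM2r c0 pq.
have apn : 0 <= a ^+ 2 * p * n%:R by apply: mulr_ge0 => //; apply: mulr_ge0; rewrite ?sqr_ge0.
move: apn; rewrite !expr2; lra.
Qed.

Lemma card_out_arcs n (v : 'I_n) (X : {set 'I_n}) : v \in X ->
  #|finset.setX [set v]%SET X :&: all_arcs n| = #|X|.-1.
Proof.
move=> vX; rewrite finset.setIC card_arcs_out big_set1 (cardsD1 v X) vX /=.
by apply: eq_card => w; rewrite !inE eq_sym andbC.
Qed.

Lemma card_in_arcs n (v : 'I_n) (X : {set 'I_n}) : v \in X ->
  #|finset.setX X [set v]%SET :&: all_arcs n| = #|X|.-1.
Proof.
move=> vX; rewrite finset.setIC card_arcs_in big_set1 (cardsD1 v X) vX /=.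
by apply: eq_card => w; rewrite !inE andbC.
Qed.

Lemma outdegE n (D : digraph n) v : outdeg D v = #|D :&: finset.setX [set v]%SET [set: 'I_n]%SET|.
Proof. by rewrite card_arcs_out big_set1; apply: eq_card => w; rewrite !inE. Qed.

Lemma indegE n (D : digraph n) v : indeg D v = #|D :&: finset.setX [set: 'I_n]%SET [set v]%SET|.
Proof. by rewrite card_arcs_in big_set1; apply: eq_card => w; rewrite !inE. Qed.

(** * Elementary facts on local resilience *)

Lemma local_resilience_ge (R : realType) n (D : digraph n) (x : R) :
  x <= n%:R -> (forall r, destroyable D r -> x <= r%:R) ->
  x <= (local_resilience_ham D)%:R.
Proof.
(* [xn] takes care of the default value [n] of the minimum. *)
move=> xn H; apply: (big_ind (fun r : nat => x <= r%:R)) => //.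
  by move=> r1 r2; rewrite /minn; case: ifP.
by move=> r; apply: H.
Qed.

Lemma local_resilience_le n (D : digraph n) (r : nat) :
  (r <= n)%N -> destroyable D r -> (local_resilience_ham D <= r)%N.
Proof.
rewrite -ltnS => rn Dr; rewrite /local_resilience_ham.
have : Ordinal rn \in index_enum 'I_n.+1 by rewrite mem_index_enum.
elim: index_enum => // i l IH; rewrite inE big_cons => /predU1P[<-|/IH le].
  by rewrite Dr geq_minl.
by case: ifP => // _; apply: leq_trans (geq_minr _ _) le.
Qed.

Lemma outdegD n (D H : digraph n) v : H \subset D ->
  (outdeg (D :\: H) v + outdeg H v = outdeg D v)%N.
Proof.
move=> HD; rewrite !outdegE -(cardsID H (D :&: _)) addnC.
by congr (_ + _)%N; apply: eq_card => x; rewrite !inE;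
  have /implyP := fintype.subsetP HD x; case: (x \in H); case: (x \in D);
  rewrite ?andbT ?andbF.
Qed.

Lemma indegD n (D H : digraph n) v : H \subset D ->
  (indeg (D :\: H) v + indeg H v = indeg D v)%N.
Proof.
move=> HD; rewrite !indegE -(cardsID H (D :&: _)) addnC.
by congr (_ + _)%N; apply: eq_card => x; rewrite !inE;
  have /implyP := fintype.subsetP HD x; case: (x \in H); case: (x \in D);
  rewrite ?andbT ?andbF.
Qed.

Lemma destroyable_half n (D : digraph n) (X : {set 'I_n}) (r : nat) :
  (n < 2 * #|X|)%N ->
  (forall v, v \in X -> (#|D :&: finset.setX [set v]%SET X| <= r)%N) ->
  (forall v, v \in X -> (#|D :&: finset.setX X [set v]%SET| <= r)%N) ->
  destroyable D r.
Proof.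
move=> nX hout hin; apply/existsP; exists (D :&: finset.setX X X : digraph n); apply/and3P; split.
- exact: finset.subsetIl.
- apply/forallP => v; have [vX|vX] := boolP (v \in X); last first.
    rewrite [outdeg _ v]eq_card0 => [|w]; last by rewrite !inE (negbTE vX) andbF.
    by rewrite [indeg _ v]eq_card0 => // w; rewrite !inE (negbTE vX) !andbF.
  apply/andP; split.
    apply: leq_trans (hout v vX); rewrite outdegE; apply: subset_leq_card.
    by apply/fintype.subsetP => -[x y]; rewrite !inE /= => /andP[/andP[-> /andP[_ ->]] /andP[-> _]].
  apply: leq_trans (hin v vX); rewrite indegE; apply: subset_leq_card.
  by apply/fintype.subsetP => -[x y]; rewrite !inE /= => /andP[/and3P[-> -> _] ->].
- apply: (not_hamiltonian_independent nX) => v w vX wX.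
  by rewrite !inE /= vX wX !andbT; case: (_ \in D).
Qed.

(* Chernoff bound for the random partition: the mean of the hypergeometric variable
   is at least (1/2 + a/2) p s, and the tail is taken below q. *)
Lemma sampling_bound (R : realType) (n s : nat) (p a q : R) :
  0 < a <= 1 / 4 -> 0 <= p <= 1 -> (2 <= n)%N ->
  n%:R ^+ 2 <= expR (a ^+ 2 / 2048 * p * s%:R) ->
  q = (1 / 2 + a / 4) * (p * s%:R) ->
  (2 * n * n)%:R * (1 - (1 - expR (- (a / 16))) * ((1 / 2 + a / 2) * p)) ^+ s <
    expR (- (a / 16)) ^+ Num.truncn q.
Proof.
move=> /andP[a0 a4] /andP[p0 p1] n2 nE qE.
set l := expR (- (a / 16)); set w := (1 - l) * ((1 / 2 + a / 2) * p).
pose x := p * s%:R.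
have x0 : 0 <= x by rewrite mulr_ge0.
have q0 : 0 <= q by rewrite qE mulr_ge0 //; lra.
have l1 : l <= 1 by rewrite /l expR_le1; lra.
have l0 : 0 < l by exact: expR_gt0.
have lq : l <= 1 - a / 16 + 2 * (a / 16) ^+ 2.
  have := @expR_le_quad R (- (a / 16)); rewrite sqrrN -/l; apply; lra.
have l2 : 1 - 2 * (a / 16) <= l by have := expR_ge1Dx (- (a / 16)); rewrite -/l; lra.
have hz : 0 <= (1 / 2 + a / 2) * p <= 1.
  have : 0 <= a * p by rewrite mulr_ge0 // ltW.
  have : a * p <= a by rewrite ger_pMr.
  by move=> *; apply/andP; split; lra.
have w1 : w <= 1.
  by have /andP[h0 h1] := hz; rewrite /w -[leRHS]mulr1 ler_pM ?subr_ge0 //; lra.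
have wE : (1 - w) ^+ s <= expR (- (w * s%:R)).
  have -> : - (w * s%:R) = s%:R * (- w) by ring.
  rewrite expRM_natl; apply: lerXn2r; rewrite ?nnegrE ?expR_ge0 ?subr_ge0 //.
  by have := expR_ge1Dx (- w); lra.
have kE : expR (- (a / 16) * q) <= l ^+ Num.truncn q.
  rewrite /l -expRM_natl ler_expR.
  have /andP[h _] := truncn_itv q0.
  have : a / 16 * (Num.truncn q)%:R <= a / 16 * q by apply: ler_wpM2l => //; lra.
  lra.
have N0 : 0 <= (2 * n * n)%:R :> R by [].
apply: lt_le_trans kE; apply: (le_lt_trans (ler_wpM2l N0 wE)).
have ws : (a / 16 - 2 * (a / 16) ^+ 2) * ((1 / 2 + a / 2) * x) <= w * s%:R.
  have -> : w * s%:R = (1 - l) * ((1 / 2 + a / 2) * x) by rewrite /w /x; ring.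
  by apply: ler_wpM2r; [rewrite mulr_ge0 //|]; lra.
(* The surplus [a / 4] of the sampled density over the threshold outweighs the quadratic error in
   [1 - l]. The factor 2 provides [n ^+ 4], which beats the number [2 * n * n] of events. *)
have gap : 2 * (a ^+ 2 / 2048 * p * s%:R) <= w * s%:R - a / 16 * q.
  have ax : 0 <= a ^+ 2 * x by rewrite mulr_ge0 ?sqr_ge0.
  have aax : a * (a ^+ 2 * x) <= 1 / 4 * (a ^+ 2 * x) by rewrite ler_wpM2r.
  have e : p * s%:R = x by [].
  rewrite qE e -(mulrA _ p) e; move: ws ax aax; rewrite !expr2 => ws ax aax.
  lra.
have E4 : n%:R ^+ 2 * n%:R ^+ 2 <= expR (w * s%:R - a / 16 * q).
  apply: le_trans (_ : expR (2 * (a ^+ 2 / 2048 * p * s%:R)) <= _); last by rewrite ler_expR.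
  by rewrite mulr_natl mulr2n expRD ler_pM ?exprn_ge0.
have e0 := expR_gt0 (w * s%:R).
rewrite -(ltr_pM2r e0) -mulrA -expRD addNr expR0 mulr1 -expRD.
rewrite (_ : - (a / 16) * q + w * s%:R = w * s%:R - a / 16 * q); last by ring.
apply: lt_le_trans E4.
rewrite -!natrX -natrM ltr_nat -[(2 * n * n)%N]mulnA mulnn ltn_pmul2r.
  by rewrite (leq_trans (n := (2 ^ 2)%N)) // leq_exp2r.
by rewrite expn_gt0 (leq_trans _ n2).
Qed.

(** The deterministic core: the degree and pseudorandomness conditions on [D] alone imply both
    bounds. [X] is the set whose inner arcs are deleted for the upper bound. *)
Lemma resilience_bounds (R : realType) (n s : nat) (p a : R) (D : digraph n)
    (X : {set 'I_n}) :
  0 < a <= 1 / 4 -> 0 < p <= 1 -> (0 < s)%N -> (2 <= n)%N ->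
  (n < s.+1 * s.+1)%N ->
  128 * s%:R <= a * (p * n%:R) -> 32 <= a * p * (p * n%:R) ->
  n%:R ^+ 2 <= expR (a ^+ 2 / 2048 * p * s%:R) ->
  D \subset all_arcs n -> #|X| = (n./2).+1 ->
  (forall v, (1 - a / 4) * (p * n%:R) <= (outdeg D v)%:R) ->
  (forall v, (1 - a / 4) * (p * n%:R) <= (indeg D v)%:R) ->
  (forall v, v \in X ->
     #|D :&: finset.setX [set v]%SET X|%:R <= (1 / 2 + a) * (p * n%:R)) ->
  (forall v, v \in X ->
     #|D :&: finset.setX X [set v]%SET|%:R <= (1 / 2 + a) * (p * n%:R)) ->
  pseudorandom D p (a / 16) n%:R s%:R -> pseudorandom D p (a / 16) s%:R n%:R ->
  pseudorandom D p (a / 16) s%:R s%:R ->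
  ((1 / 2 - a) * n%:R * p <= (local_resilience_ham D)%:R) &&
  ((local_resilience_ham D)%:R <= (1 / 2 + a) * n%:R * p).
Proof.
move=> a01 p01 s0 n2 ns2 sa ha nE DN cX d1 d2 u1 u2 P1 P2 P3.
have /andP[a0 a4] := a01; have /andP[pgt0 p1] := p01; have p0 := ltW pgt0.
have n0 : 0 < n%:R :> R by rewrite ltr0n (leq_trans _ n2).
have a1 : a <= 1 by lra.
have pn0 : 0 < p * n%:R by rewrite mulr_gt0.
have apn : a * (p * n%:R) <= 1 / 4 * (p * n%:R) by rewrite ler_wpM2r // ltW.
have apn0 : 0 <= a * (p * n%:R) by rewrite mulr_ge0 // ltW.
have pn : p * n%:R <= n%:R by rewrite ger_pMl.
(* Degrees of at least [1 - a/4] minus a loss below [1/2 - a], in units of [p n], leave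
   [1/2 + 3a/4]. *)
have deg_sub (d d' r : nat) : (1 - a / 4) * (p * n%:R) <= d%:R -> (d <= d' + r)%N ->
    r%:R < (1 / 2 - a) * n%:R * p -> (1 / 2 + 3 / 4 * a) * (p * n%:R) <= d'%:R.
  by rewrite -(ler_nat R) natrD; clear; lra.
have a16 : - (a / 16) <= 0 by clear -a0; lra.
have lo_n : (1 / 2 - a) * n%:R * p <= n%:R by clear -apn0 pn pn0; lra.
have s16 : 16 * s%:R <= a / 8 * (p * n%:R) by clear -sa; lra.
have half0 : 0 <= 1 / 2 + a by clear -a0; lra.
have quarter0 : 0 <= 1 / 2 + a / 4 by clear -a0; lra.
have hi_n : (1 / 2 + a) * (p * n%:R) <= n%:R by clear -apn pn pn0; lra.
apply/andP; split.
- apply: local_resilience_ge; first exact: lo_n.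
  move=> r /existsP[H /and3P[HD /forallP Hr nH]]; rewrite leNgt; apply: contra nH => rlt.
  pose q := (1 / 2 + a / 4) * (p * s%:R).
  have q0 : 0 <= q by rewrite !mulr_ge0.
  apply: (@robust_hamiltonian R n (D :\: H) D p a (expR (- (a / 16))) s (Num.truncn q)) => //.
  + exact: finset.subsetDl.
  + move=> v; apply/negP; rewrite inE => /andP[_ /(fintype.subsetP DN)].
    by rewrite inE eqxx.
  + by apply: leq_trans n2.
  + move=> v; apply: deg_sub (d1 v) _ rlt.
    by rewrite -(outdegD v HD) leq_add2l; have /andP[] := Hr v.
  + move=> v; apply: deg_sub (d2 v) _ rlt.
    by rewrite -(indegD v HD) leq_add2l; have /andP[] := Hr v.
  + by rewrite expR_gt0 expR_le1.
  + by have /andP[_ /ltW] := truncn_itv q0.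
  + by apply: sampling_bound => //; rewrite p0.
- have x0 : 0 <= (1 / 2 + a) * (p * n%:R) by rewrite mulr_ge0 // ltW.
  have /andP[r1 r2] := truncn_itv x0; set r := Num.truncn _ in r1 r2.
  have le_r (k : nat) : k%:R <= (1 / 2 + a) * (p * n%:R) -> (k <= r)%N.
    by move=> h; rewrite truncn_ge_nat.
  rewrite -mulrA [n%:R * p]mulrC; apply: (le_trans _ r1).
  rewrite ler_nat; apply: local_resilience_le.
    by rewrite -(ler_nat R) (le_trans r1).
  apply: (destroyable_half (X := X)).
  + by rewrite cX; clear; lia.
  + by move=> v vX; apply: le_r; apply: u1.
  + by move=> v vX; apply: le_r; apply: u2.
Qed.

(** The power is at most [expR (2 / n)], which is at most [1 + 2 / n + 8 / n^2]. *)
Lemma compound_bound (R : realType) (n : nat) (y : R) :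
  64 <= n%:R :> R -> 0 <= y -> n%:R * y <= n%:R^-1 -> (1 + y) ^+ (2 * n) - 1 <= 4 / n%:R.
Proof.
move=> n64 y0 ny.
have n0 : 0 < n%:R :> R by lra.
have i64 : n%:R^-1 <= 1 / 64 :> R by rewrite div1r lef_pV2 ?posrE.
have i0 : 0 < n%:R^-1 :> R by rewrite invr_gt0.
have h2 : (1 + y) ^+ (2 * n) <= expR (2 * n%:R^-1).
  apply: (@le_trans _ _ (expR y ^+ (2 * n))).
    apply: lerXn2r; rewrite ?nnegrE ?expR_ge0 ?addr_ge0 //.
    exact: expR_ge1Dx.
  by rewrite -expRM_natl ler_expR natrM -mulrA ler_wpM2l.
have h3 : expR (2 * n%:R^-1) <= 1 + 2 * n%:R^-1 + 2 * (2 * n%:R^-1) ^+ 2 :> R.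
  by apply: expR_le_quad; lra.
have h4 : n%:R^-1 * n%:R^-1 <= 1 / 64 * n%:R^-1 :> R by rewrite ler_wpM2r // ltW.
move: h3; rewrite expr2 => h3; lra.
Qed.

(** Union bound: four degree conditions fail with probability at most [1 / n] each, three
    pseudorandomness conditions with at most [4 / n] each, in total [16 / n]. *)
Lemma resilience_prob (R : realType) (n s : nat) (p a : R) :
  0 < a <= 1 / 4 -> 0 <= p <= 1 -> (0 < s)%N -> (s <= n)%N ->
  (n < s.+1 * s.+1)%N ->
  128 * s%:R <= a * (p * n%:R) -> 32 <= a * p * (p * n%:R) -> 16 <= a * n%:R ->
  n%:R ^+ 2 <= expR (a ^+ 2 / 2048 * p * s%:R) ->
  1 - 16 / n%:R <= Dnp_prob p (fun D : digraph n =>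
    ((1 / 2 - a) * n%:R * p <= (local_resilience_ham D)%:R) &&
    ((local_resilience_ham D)%:R <= (1 / 2 + a) * n%:R * p)).
Proof.
move=> a01 p01 s0 sn ns2 sa ha an nE.
have /andP[a0 a4] := a01; have /andP[p0 p1] := p01.
have a1 : 0 < a <= 1 by rewrite a0; clear -a4; lra.
have c02 : 0 < a / 16 <= 2 by rewrite divr_gt0 //; clear -a4; lra.
have n64 : 64 <= n%:R :> R.
  have : a * n%:R <= 1 / 4 * n%:R by rewrite ler_wpM2r.
  lra.
have n64N : (64 <= n)%N by rewrite -(ler_nat R).
have n0 : 0 < n%:R :> R by lra.
have s0R : 0 < s%:R :> R by rewrite ltr0n.
have snR : s%:R <= n%:R :> R by rewrite ler_nat.
have pgt0 : 0 < p.
  rewrite lt_neqAle p0 andbT; apply: contraTneq ha => <-.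
  by rewrite mulr0 mul0r; lra.
pose y : R := expR (- (a ^+ 2 / 2048 * p * s%:R)).
have y0 : 0 <= y by exact: expR_ge0.
have yn : y <= (n%:R ^+ 2)^-1.
  by rewrite /y expRN lef_pV2 ?posrE ?expR_gt0 ?exprn_gt0.
have nn : n%:R * (n%:R ^+ 2)^-1 = n%:R^-1 :> R.
  by rewrite expr2 invfM mulrA mulfV ?mul1r // gt_eqF.
have ny : n%:R * y <= n%:R^-1 by rewrite -nn ler_wpM2l // ltW.
have deg_bound : n%:R * expR (- (a ^+ 2 / 256 * p * n%:R)) <= n%:R^-1.
  apply: le_trans ny; rewrite ler_wpM2l ?ler_expR ?(ltW n0) //.
  have a2p : 0 <= a ^+ 2 * p by rewrite mulr_ge0 ?sqr_ge0.
  have : a ^+ 2 * p * s%:R <= a ^+ 2 * p * n%:R by rewrite ler_wpM2l.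
  have : 0 <= a ^+ 2 * p * n%:R by rewrite mulr_ge0.
  clear; lra.
have pr_bound A B : s%:R <= A -> s%:R <= B ->
    Dnp_prob p (fun D : digraph n => ~~ `[< pseudorandom D p (a / 16) A B >]) <= 4 / n%:R.
  move=> sA sB; have := @pseudorandom_prob R n p (a / 16) A B s%:R p01 c02 (ltW s0R) sA sB.
  have -> : (a / 16) ^+ 2 / 8 * p * s%:R = a ^+ 2 / 2048 * p * s%:R by field.
  rewrite -/y => h; apply: (le_trans h).
  exact: compound_bound.
(* [X] is fixed before the digraph is drawn, so the tail bounds apply to the degrees inside it. *)
have [X _ cX] : exists2 X : {set 'I_n}, X \subset [set: 'I_n]%SET & #|X| = (n./2).+1.
  apply: subset_of_size; rewrite cardsT card_ord; clear -n64N; lia.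
have sv v : v \in [set: 'I_n]%SET by rewrite finset.in_setT.
pose lo_out (D : digraph n) := [exists v, (outdeg D v)%:R < (1 - a / 4) * (p * n%:R)].
pose lo_in (D : digraph n) := [exists v, (indeg D v)%:R < (1 - a / 4) * (p * n%:R)].
pose hi_out (D : digraph n) := [exists v, (v \in X) && ((1 / 2 + a) * (p * n%:R) <
  #|D :&: finset.setX [set v]%SET X|%:R)].
pose hi_in (D : digraph n) := [exists v, (v \in X) && ((1 / 2 + a) * (p * n%:R) <
  #|D :&: finset.setX X [set v]%SET|%:R)].
pose ps A B (D : digraph n) := `[< pseudorandom D p (a / 16) A B >].
pose bad D := lo_out D || (lo_in D || (hi_out D || (hi_in D ||
  (~~ ps n%:R s%:R D || (~~ ps s%:R n%:R D || ~~ ps s%:R s%:R D))))).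
have Pbad : Dnp_prob p bad <= 16 / n%:R.
  have U E F x z : Dnp_prob p E <= x -> Dnp_prob p F <= z ->
      Dnp_prob (n := n) p (fun D => E D || F D) <= x + z.
    by move=> h1 h2; apply: le_trans (Dnp_prob_or _ _ p01) _; rewrite lerD.
  have B1 : Dnp_prob p lo_out <= n%:R^-1.
    apply: le_trans deg_bound.
    apply: (low_degree_prob p01 a1 an (S := fun v => [set v]%SET) (U := fun=> [set: 'I_n]%SET)).
      by move=> v D; apply: outdegE.
    by move=> v; rewrite card_out_arcs // cardsT card_ord.
  have B2 : Dnp_prob p lo_in <= n%:R^-1.
    apply: le_trans deg_bound.
    apply: (low_degree_prob p01 a1 an (S := fun=> [set: 'I_n]%SET) (U := fun v => [set v]%SET)).
      by move=> v D; apply: indegE.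
    by move=> v; rewrite card_in_arcs // cardsT card_ord.
  have B3 : Dnp_prob p hi_out <= n%:R^-1.
    apply: le_trans deg_bound.
    apply: (high_degree_prob p01 a1 (S := fun v => [set v]%SET) (U := fun=> X)) => //.
    by move=> v vX; rewrite card_out_arcs // cX /=; clear; lia.
  have B4 : Dnp_prob p hi_in <= n%:R^-1.
    apply: le_trans deg_bound.
    apply: (high_degree_prob p01 a1 (S := fun=> X) (U := fun v => [set v]%SET)) => //.
    by move=> v vX; rewrite card_in_arcs // cX /=; clear; lia.
  have := U _ _ _ _ B1 (U _ _ _ _ B2 (U _ _ _ _ B3 (U _ _ _ _ B4
    (U _ _ _ _ (pr_bound _ _ snR (lexx _)) (U _ _ _ _ (pr_bound _ _ (lexx _) snR)
      (pr_bound _ _ (lexx _) (lexx _))))))).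
  by move=> h; apply: (le_trans h); clear; lra.
apply: (@le_trans _ _ (1 - Dnp_prob p bad)); first by clear -Pbad; lra.
have -> : 1 - Dnp_prob p bad = Dnp_prob p (fun D => ~~ bad D).
  by rewrite [RHS]Dnp_probC; congr (1 - _); apply: eq_bigr => D _; rewrite negbK.
apply: Dnp_prob_le => // D DN.
rewrite /bad 6!negb_or /lo_out /lo_in /hi_out /hi_in.
case/and5P=> /existsPn d1 /existsPn d2 /existsPn u1 /existsPn u2 /and3P[/negbNE/asboolP P1 /negbNE/asboolP P2 /negbNE/asboolP P3].
apply: (resilience_bounds (X := X) a01 _ s0 _ ns2 sa ha nE DN cX _ _ _ _ P1 P2 P3).
- by rewrite pgt0.
- exact: leq_trans n64N.
- by move=> v; have := d1 v; rewrite -leNgt.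
- by move=> v; have := d2 v; rewrite -leNgt.
- by move=> v vX; have := u1 v; rewrite vX /= -leNgt.
- by move=> v vX; have := u2 v; rewrite vX /= -leNgt.
Qed.

(** * Passage to the limit *)

Import numFieldTopology.Exports numFieldNormedType.Exports.
Unset Implicit Arguments.
Local Open Scope classical_set_scope.
Local Open Scope ring_scope.

(** Takes [s] to be the integer part of the square root of [n]. The constant [128 * 64] is 4 times
    2048: one factor 2 for the square in [n ^+ 2], one for rounding the root down to [s]. *)
Lemma resilience_prob_dense (R : realType) (n : nat) (p a : R) :
  0 < a <= 1 / 4 -> 0 <= p <= 1 -> 16 <= a * n%:R -> expR 1 <= n%:R :> R ->
  (128 * 64) / a ^+ 2 <= p * Num.sqrt n%:R / ln n%:R ->
  1 - 16 / n%:R <= Dnp_prob p (fun D : digraph n =>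
    ((1 / 2 - a) * n%:R * p <= (local_resilience_ham D)%:R) &&
    ((local_resilience_ham D)%:R <= (1 / 2 + a) * n%:R * p)).
Proof.
move=> a01 p01 an en; have /andP[a0 a4] := a01; have /andP[p0 p1] := p01.
have n0 : 0 < n%:R :> R by apply: lt_le_trans en; apply: expR_gt0.
have ln1 : 1 <= ln (n%:R : R) by rewrite -[leLHS]expRK ler_ln ?posrE ?expR_gt0.
have ln0 : 0 < ln (n%:R : R) by apply: lt_le_trans ln1.
set K := (128 * 64) / _; set w := Num.sqrt n%:R; set L := ln _ in ln1 ln0 *.
rewrite ler_pdivlMr // => KL.
have a2 : 0 < a ^+ 2 by rewrite exprn_gt0.
have KE : K * a ^+ 2 = (128 * 64) by rewrite /K divfK // gt_eqF.
have c0 : 0 < 128 * 64 :> R by lra.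
have K0 : 0 < K by rewrite /K divr_gt0.
have w0 : 0 <= w by apply: sqrtr_ge0.
have ww : w * w = n%:R by rewrite -expr2 sqr_sqrtr // ltW.
have n1 : 1 <= n%:R :> R by apply: le_trans en; have := expR_ge1Dx (1 : R); lra.
have w1 : 1 <= w by rewrite /w -[leLHS]sqrtr1 ler_wsqrtr.
have Kw : K <= p * w.
  by apply: le_trans KL; rewrite -[leLHS]mulr1 ler_wpM2l // ltW.
have aK : 128 <= a * K.
  have : a * (a * K) <= 1 / 4 * (a * K) by rewrite ler_wpM2r // mulr_ge0 // ltW.
  by move: KE; rewrite expr2; lra.
have apw : 128 <= a * (p * w).
  by apply: (le_trans aK); rewrite ler_wpM2l // ltW.
have /andP[sw ws] := truncn_itv w0; set s := Num.truncn w in sw ws.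
have s0 : (0 < s)%N by rewrite truncn_gt0.
have s1 : 1 <= s%:R :> R by rewrite ler1n.
rewrite -natr1 in ws.
apply: (@resilience_prob R n s) => //.
- rewrite -(ler_nat R) -ww; apply: (le_trans sw); rewrite -[leLHS]mulr1.
  by rewrite ler_wpM2l.
- by rewrite -(ltr_nat R) natrM -natr1 -ww; apply: ltr_pM.
- have h : 128 * w <= a * (p * w) * w by rewrite ler_wpM2r.
  rewrite -ww; lra.
- have h : 128 * 1 <= a * (p * w) * (p * w).
    apply: ler_pM => //; have : a * (p * w) <= p * w by rewrite ger_pMl; lra.
    lra.
  rewrite -ww; lra.
- rewrite -[in leLHS](@lnK R n%:R) ?posrE // -expRM_natl ler_expR -/L.
  have h : a ^+ 2 * (K * L) <= a ^+ 2 * (p * w) by rewrite ler_wpM2l // ltW.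
  (* [w < s + 1 <= 2 * s], as [s] is at least 1. *)
  have h1 : a ^+ 2 * p * w <= a ^+ 2 * p * (2 * s%:R).
    by rewrite ler_wpM2l ?mulr_ge0 ?(ltW a2) //; lra.
  have : a ^+ 2 * (K * L) = (128 * 64) * L by rewrite mulrA [_ * K]mulrC KE.
  lra.
Qed.

Theorem theorem1p1 (R : realType) (alpha : R) (p : nat -> R) :
  0 < alpha ->
  (forall n, 0 <= p n <= 1) ->
  (fun n : nat => p n * Num.sqrt (n%:R : R) / ln (n%:R : R)) @ \oo --> +oo ->
  (fun n : nat =>
     Dnp_prob (p n)
       (fun D : digraph n =>
          ((1 / 2 - alpha) * n%:R * p n <= (local_resilience_ham D)%:R)
          && ((local_resilience_ham D)%:R <= (1 / 2 + alpha) * n%:R * p n)))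
    @ \oo --> (1 : R).
Proof.
move=> alpha0 p01 /cvgryPge dense.
(* The estimates need a small constant; the bounds for the smaller [a] imply those for [alpha]. *)
pose a : R := Num.min alpha (1 / 4).
have aal : a <= alpha by rewrite /a ge_min lexx.
have a01 : 0 < a <= 1 / 4 by rewrite /a lt_min alpha0 ge_min lexx orbT andbT; lra.
have /andP[a0 _] := a01.
apply/cvgrPdist_le => e e0; near=> n.
have n0 : 0 < n%:R :> R.
  by apply: (@lt_le_trans _ _ (expR 1)); [exact: expR_gt0|near: n; exact: nbhs_infty_ger].
have np0 : 0 <= n%:R * p n by rewrite mulr_ge0 ?(ltW n0) //; have /andP[] := p01 n.
have P1 : Dnp_prob (p n) (fun D : digraph n =>
    ((1 / 2 - alpha) * n%:R * p n <= (local_resilience_ham D)%:R)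
    && ((local_resilience_ham D)%:R <= (1 / 2 + alpha) * n%:R * p n)) <= 1.
  by rewrite Dnp_probC lerBlDr lerDl Dnp_prob_ge0.
rewrite ger0_norm ?subr_ge0 // lerBlDr -lerBlDl.
apply: (@le_trans _ _ (1 - 16 / n%:R)).
  rewrite lerD2l lerN2 ler_pdivrMr // mulrC -ler_pdivrMr //.
  by near: n; exact: nbhs_infty_ger.
apply: (le_trans (@resilience_prob_dense R n (p n) a a01 (p01 n) _ _ _)).
- rewrite mulrC -ler_pdivrMr //; near: n; exact: nbhs_infty_ger.
- by near: n; exact: nbhs_infty_ger.
- by near: n; apply: dense.
apply: Dnp_prob_le => // D _ /andP[h1 h2].
have : a * (n%:R * p n) <= alpha * (n%:R * p n) by rewrite ler_wpM2r.
by move=> h; apply/andP; split; [apply: le_trans h1|apply: (le_trans h2)]; lra.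
Unshelve. all: by end_near.
Qed.
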